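(* Let $\pi_0,\dots,\pi_{M-1}$ be prior probabilities with $\pi_m>0$ for all $m$, and let $W(m,m')$ be losses with $W(m,m)=0$ and $W(m,m')>0$ for $m\neq m'$. Let $\delta(c)$ be the two-stage test (described in the context) whose second-stage quantizers are $\bar\phi_0,\dots,\bar\phi_{M-1}\in\bar\Phi$. Assume each $\bar\phi_m$ is a randomization of finitely many deterministic quantizers, and that $I(m;\bar\phi_{m'})>0$ for all $m,m'\in\{0,\dots,M-1\}$. Then, as $c\to0$, the total number of time steps $N$ of $\delta(c)$ satisfies $$\mathbf E_m\{N\}=(1+o(1))\,|\log c|/I(m;\bar\phi_m),\qquad m=0,\dots,M-1,$$ its final decision $D$ satisfies $\mathbf P_m\{D\neq m\}=O(c)$ for $m=0,\dots,M-1$, and consequently its Bayes risk satisfies $$\mathcal R_c(\delta(c))=(1+o(1))\,c|\log c|\sum_{m=0}^{M-1}\pi_m/I(m;\bar\phi_m).$$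
   Context: Setting: a single sensor observes raw data $X_1,X_2,\dots$ which, under state $m\in\{0,\dots,M-1\}$ (probability $\mathbf P_m$, expectation $\mathbf E_m$), are i.i.d. with density $f_m$ with respect to a common $\sigma$-finite measure. Standing assumption: for all $m\neq m'$, $0<\mathbf E_m[\log(f_m(X_1)/f_{m'}(X_1))]<\infty$. Sensor messages are binary, in $\{0,1\}$. A deterministic quantizer is a measurable map $\phi$ from the observation space to $\{0,1\}$; $\Phi$ is the set of these. A randomized quantizer $\bar\phi=\sum_j p^j\phi^j$ is a probability distribution $(p^j)$ on a countable set $\{\phi^j\}\subset\Phi$; deterministic quantizers are identified with randomized ones putting mass one on themselves; $\bar\Phi$ is the set of all quantizers. For $\phi\in\Phi$, $f_m(u;\phi)=\mathbf P_m(\phi(X_1)=u)$ and $I(m,m';\phi)=\sum_{u}f_m(u;\phi)\log\frac{f_m(u;\phi)}{f_{m'}(u;\phi)}$; for $\bar\phi=\sum_jp^j\phi^j$, $I(m,m';\bar\phi)=\sum_jp^jI(m,m';\phi^j)$; and $I(m;\bar\phi)=\min_{m'\neq m}I(m,m';\bar\phi)$. Bayes risk of a test $\delta$ with stopping time $N$ and final decision $D$: $\mathcal R_c(\delta)=\sum_m\pi_m\big(c\,\mathbf E_m N+\sum_{m'}W(m,m')\mathbf P_m\{D=m'\}\big)$, with cost $c>0$ per time step. Two-stage test $\delta(c)$: Fix $u(c)\in(0,1/2)$ with $u(c)\to0$ and $\log u(c)/\log c\to0$ as $c\to0$, and a deterministic quantizer $\phi^0$ with $I(m,m';\phi^0)>0$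 for all $m\neq m'$. First stage: the sensor sends $U_n=\phi^0(X_n)$; the fusion center starts from $\pi_{m,0}=\pi_m$ and updates posteriors $\pi_{m,n}=\pi_{m,n-1}f_m(U_n;\phi^0)/\sum_{m'}\pi_{m',n-1}f_{m'}(U_n;\phi^0)$; it stops the first stage at $N_0=\min\{n\ge0:\max_m\pi_{m,n}\ge1-u(c)\}$ and sets $D_0=\arg\max_m\pi_{m,N_0}$. Second stage: if $D_0=m$ the sensor uses the stationary quantizer $\bar\phi_m=\sum_jp^j\phi^j$, implemented so that at each time $n$ a deterministic quantizer $\phi^{j(n)}$ is selected with probabilities $p^j$ independently of everything else, the fusion center knows $j(n)$, and $U_n=\phi^{j(n)}(X_n)$; the fusion center continues updating $\pi_{m,n}=\pi_{m,n-1}f_m(U_n;\phi^{j(n)})/\sum_{m'}\pi_{m',n-1}f_{m'}(U_n;\phi^{j(n)})$, stops at $N=\min\{n\ge N_0:\max_m\pi_{m,n}\ge1-c\}$ and decides $D=\arg\max_m\pi_{m,N}$. *)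

(* Defs.v *)
From HB Require Import structures.
From mathcomp Require Import all_boot all_order all_algebra.
From mathcomp Require Import all_classical all_reals all_analysis.
Set Implicit Arguments. Unset Strict Implicit. Unset Printing Implicit Defensive.
Import Order.TTheory GRing.Theory Num.Theory.
Import numFieldNormedType.Exports.
Local Open Scope classical_set_scope.
Local Open Scope ring_scope.

Definition first_hit (Q : pred nat) : option nat :=
  match pselect (exists n, Q n) with
  | left h => Some (ex_minn h)
  | right _ => None
  end.

Definition mutually_independent {d} {Omega : measurableType d} {R : realType}
  (P : probability Omega R) {I : eqType} (E : I -> set (set Omega)) : Prop :=
  forall (s : seq I) (A : I -> set Omega),
    uniq s -> (forall i, i \in s -> E i (A i)) ->
    P (\big[setI/setT]_(i <- s) A i) = (\prod_(i <- s) P (A i))%E.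

Section TwoStage.
Context {R : realType} {d : measure_display} {Omega : measurableType d}
        {T : Type} {M : nat}.
Variables (P : 'I_M -> probability Omega R)
          (X : nat -> Omega -> T).
(* X n is the raw observation X_{n+1} *)

Definition qprob (m : 'I_M) (phi : T -> bool) (u : bool) : R :=
  fine (P m [set w | phi (X 0%N w) = u]).

Definition KLq (m m' : 'I_M) (phi : T -> bool) : R :=
  \sum_(u : bool) qprob m phi u * ln (qprob m phi u / qprob m' phi u).

(* I(m,m';phibar) for the randomized quantizer sum_{k<K} p k * phi k *)
Definition KLr (m m' : 'I_M) (K : nat) (p : nat -> R) (phi : nat -> T -> bool) : R :=
  \sum_(k < K) p k * KLq m m' (phi k).

Definition Imin (m : 'I_M) (K : nat) (p : nat -> R) (phi : nat -> T -> bool) : R :=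
  fine (\big[Order.min/+oo%E]_(m' : 'I_M | m' != m) (KLr m m' K p phi)%:E).

Definition bayes_update (pi lik : 'I_M -> R) : 'I_M -> R :=
  fun m => pi m * lik m / \sum_(m' < M) pi m' * lik m'.

(* posterior process; q n w is the deterministic quantizer used at time n+1 *)
Fixpoint posterior (prior : 'I_M -> R) (q : nat -> Omega -> T -> bool)
    (n : nat) (w : Omega) : 'I_M -> R :=
  match n with
  | 0 => prior
  | n'.+1 => bayes_update (posterior prior q n' w)
               (fun m => qprob m (q n' w) (q n' w (X n' w)))
  end.

Definition maxpost (pi : 'I_M -> R) : R := \big[Num.max/0]_(m < M) pi m.

Definition argmaxpost (pi : 'I_M -> R) : option 'I_M :=
  match [pick i : 'I_M] with
  | Some i0 => Some (Order.arg_max i0 xpredT pi)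
  | None => None
  end.

Variables (prior : 'I_M -> R) (phi0 : T -> bool)
          (K : 'I_M -> nat) (p : 'I_M -> nat -> R) (phi : 'I_M -> nat -> T -> bool)
          (J : 'I_M -> nat -> Omega -> nat).
(* J m n : index of the deterministic quantizer selected at time n+1 when the
   second stage uses phibar_m (drawn with probabilities p m _) *)

Definition post0 : nat -> Omega -> 'I_M -> R := posterior prior (fun _ _ => phi0).

Definition N0 (u : R) (w : Omega) : option nat :=
  first_hit (fun n => 1 - u <= maxpost (post0 n w)).

Definition D0 (u : R) (w : Omega) : option 'I_M :=
  match N0 u w with Some n0 => argmaxpost (post0 n0 w) | None => None end.

Definition quant2 (u : R) (n : nat) (w : Omega) : T -> bool :=
  match N0 u w, D0 u w with
  | Some n0, Some m => if (n < n0)%N then phi0 else phi m (J m n w)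
  | _, _ => phi0
  end.

Definition post2 (u : R) : nat -> Omega -> 'I_M -> R := posterior prior (quant2 u).

Definition Ntot (c u : R) (w : Omega) : option nat :=
  match N0 u w with
  | Some n0 => first_hit (fun n => (n0 <= n)%N && (1 - c <= maxpost (post2 u n w)))
  | None => None
  end.

Definition Dfin (c u : R) (w : Omega) : option 'I_M :=
  match Ntot c u w with Some n => argmaxpost (post2 u n w) | None => None end.

Definition Ntot_ext (c u : R) (w : Omega) : \bar R :=
  match Ntot c u w with Some n => (n%:R)%:E | None => +oo%E end.

Definition EN (c u : R) (m : 'I_M) : \bar R := \int[P m]_w Ntot_ext c u w.

Definition bayes_risk (W : 'I_M -> 'I_M -> R) (c u : R) : \bar R :=
  (\sum_(m < M) (prior m)%:E *
     (c%:E * EN c u m +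
      \sum_(m' < M) (W m m')%:E * P m [set w | Dfin c u w = Some m']))%E.

End TwoStage.

(* Main.v *)
Require Import Defs.
From HB Require Import structures.
From mathcomp Require Import all_boot all_order all_algebra.
From mathcomp Require Import all_classical all_reals all_analysis.
From mathcomp Require Import measurable_realfun.
From mathcomp Require Import ring lra.
Set Implicit Arguments. Unset Strict Implicit. Unset Printing Implicit Defensive.
Import Order.TTheory GRing.Theory Num.Theory.
Import numFieldNormedType.Exports.
Local Open Scope classical_set_scope.
Local Open Scope ring_scope.

(** Everything the fusion center sees is a function of an i.i.d. sequence of
    symbols taking, almost surely, finitely many values, and every message in
    use has positive probability under all states, so all log-likelihood ratios
    have bounded increments.

    For such products of ratios Ville's maximal inequality holds.  Applied to
    the likelihood ratio of k against m it bounds P_m(D = k) by a multiple of c;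
    applied to exponentially tilted sums it shows that, for fixed dl > 0, the
    last time s at which some log-likelihood walk leaves the cone of width dl n
    around its drift has geometric tails, hence finite mean.

    The rest is pathwise.  With lam = |log u| and ell = |log c|, the first stage
    lasts O(s + lam) steps; if its decision is m, the second stage ends within
    ell / (I(m) - dl) + O(s + lam) steps, and if it is wrong then s is at least
    of order lam, so that the extra O(ell) steps cost O(ell E[s] / lam) = o(ell)
    on average.  Conversely, for fixed s and small c the total time is at least
    (ell - O(s + lam)) / (I(m) + dl). *)

(** The family of quantizers used in the second stage depends on the past, so the messages received
    are not i.i.d. The remedy is to let every family send at every time: the vector of all these
    messages is i.i.d. under each state, and the log-likelihood ratio seen by the test is a
    first-stage walk up to its end [n0] plus a difference of two values of the walk of one fixed
    family. Cone bounds hold for walks started at time zero, and subtracting the value at [n0] costs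
    only a multiple of the length of the first stage.

    The time s serves all families and all competing states at once and does not depend on c, so its
    mean is one constant for the whole limit. Positivity of I(m; phibar_k) also for k different from
    m keeps every walk drifting towards the truth after a wrong first decision. The threshold u(c)
    meets two opposite demands: it must tend to zero, so that lam grows and wrong first decisions
    become rare, but so slowly that lam = o(ell) and the first stage is free to first order. *)

Lemma expR_le_quadratic (R : realType) (x : R) :
  x <= 1 / 2 -> expR x <= 1 + x + 2 * x ^+ 2.
Proof.
move=> x12; have h := expR_ge1Dx (- x).
have x1 : 0 < 1 - x by lra.
have e0 := expR_gt0 x.
have eE : expR x * expR (- x) = 1 by rewrite -expRD subrr expR0.
(* Both sides are compared with 1 / (1 - x); the hypothesis x <= 1/2 enters through the sign of 1 -
   2 x in [h2]. *)
have h1 : expR x * (1 - x) <= 1 by rewrite -[leRHS]eE ler_wpM2l// ltW.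
have h2 : 1 <= (1 + x + 2 * x ^+ 2) * (1 - x).
  have h3 : 0 <= x ^+ 2 * (1 - 2 * x) by rewrite mulr_ge0 ?sqr_ge0//; lra.
  by rewrite [leRHS](_ : _ = 1 + x ^+ 2 * (1 - 2 * x)); [lra | ring].
by rewrite -(ler_pM2r x1); exact: le_trans h1 h2.
Qed.

(** Second-order expansion: the mean of exp(t g) is at most 1 - t d + 2 (t B)^2 <= 1 - t d / 2 for
    small t. The surplus k = t d / 2 left in the exponent is what becomes a geometric rate later. *)
Lemma exponential_tilt (R : realType) (E : eqType) (s : seq E) (mu g : E -> R)
    (B d : R) :
  (forall e, 0 <= mu e) -> \sum_(e <- s) mu e = 1 -> 0 < d ->
  {in s, forall e, `|g e| <= B} -> \sum_(e <- s) mu e * g e <= - d ->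
  exists t k : R, [/\ 0 < t, 0 < k &
    \sum_(e <- s) mu e * expR (t * g e + k) <= 1].
Proof.
move=> mu0 mu1 d0 gB gd.
pose B' := Num.max B 1.
have B'1 : 1 <= B' by rewrite le_max lexx orbT.
have B'B : B <= B' by rewrite le_max lexx.
have B'0 : 0 < B' by apply: lt_le_trans B'1.
(* The first cap brings t g into the range of the quadratic bound; the second makes the quadratic
   term at most half of the linear gain t d. Taking [B'] at least 1 makes both quotients
   meaningful. *)
pose t := Num.min (1 / (2 * B')) (d / (4 * B' ^+ 2)).
have t0 : 0 < t by rewrite lt_min !divr_gt0 ?mulr_gt0 ?exprn_gt0.
have t1 : t * B' <= 1 / 2.
  have : t <= 1 / (2 * B') by rewrite ge_min lexx.
  by rewrite ler_pdivlMr ?mulr_gt0//; lra.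
have t2 : t * (4 * B' ^+ 2) <= d.
  have : t <= d / (4 * B' ^+ 2) by rewrite ge_min lexx orbT.
  by rewrite ler_pdivlMr ?mulr_gt0 ?exprn_gt0.
exists t, (t * d / 2); split => //; first by rewrite !mulr_gt0.
have h1 : \sum_(e <- s) mu e * expR (t * g e) <= expR (- (t * d / 2)).
  apply: (@le_trans _ _ (1 - t * d + 2 * (t * B') ^+ 2)); last first.
    apply: le_trans (expR_ge1Dx _).
    suff : 2 * (t * B') ^+ 2 <= t * d / 2 by lra.
    have := ler_wpM2l (ltW t0) t2.
    rewrite (_ : t * (t * (4 * B' ^+ 2)) = 4 * (t * B') ^+ 2); first lra.
    by ring.
  apply: (@le_trans _ _ (\sum_(e <- s) (mu e + t * (mu e * g e)
      + mu e * (2 * (t * B') ^+ 2)))); last first.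
    rewrite !big_split/= -mulr_sumr -mulr_suml mu1 mul1r.
    by have := ler_wpM2l (ltW t0) gd; rewrite mulrN; lra.
  rewrite big_seq [leRHS]big_seq; apply: ler_sum => e es.
  have tge : `|t * g e| <= t * B'.
    by rewrite normrM gtr0_norm// ler_pM2l//; apply: le_trans B'B; exact: gB.
  rewrite [leRHS](_ : _ = mu e * (1 + t * g e + 2 * (t * B') ^+ 2)); last by ring.
  apply: ler_wpM2l => //.
  apply: le_trans (expR_le_quadratic _) _.
    by apply: le_trans (ler_norm _) _; exact: le_trans tge t1.
  rewrite lerD2l ler_pM2l// -real_normK ?num_real//.
  by rewrite lerXn2r// ?nnegrE ?normr_ge0 ?mulr_ge0 ?ltW.
rewrite (eq_bigr (fun e => mu e * expR (t * g e) * expR (t * d / 2))); last first.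
  by move=> e _; rewrite expRD mulrA.
rewrite -mulr_suml; apply: le_trans (ler_wpM2r (expR_ge0 _) h1) _.
by rewrite -expRD addNr expR0.
Qed.

Lemma measure_bigsetU_le {d} {T : measurableType d} {R : realType}
    (P : {measure set T -> \bar R}) (I : Type) (s : seq I) (F : I -> set T) :
  (forall i, measurable (F i)) ->
  (P (\big[setU/set0]_(i <- s) F i) <= \sum_(i <- s) P (F i))%E.
Proof.
move=> mF; elim: s => [|i s IH]; first by rewrite !big_nil measure0.
rewrite !big_cons; apply: le_trans (measureU2 _ _ _) _ => //.
  by apply: bigsetU_measurable.
by apply: leeD.
Qed.

(** * Maximal inequality and large deviations for i.i.d. symbols *)

Section AdaptedProcess.
Context {R : realType} {d : measure_display} {Omega : measurableType d}
        (P : probability Omega R) {E : countType} (Z : nat -> Omega -> E).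

Definition hist (n : nat) (w : Omega) : seq E := mkseq (Z^~ w) n.

Lemma hist_eqP n w w' :
  (forall i, (i < n)%N -> Z i w = Z i w') <-> hist n w = hist n w'.
Proof.
split=> [h|h i ni].
  by apply: (@eq_from_nth _ (Z 0 w)) => [|i]; rewrite !size_mkseq// => ni;
    rewrite !nth_mkseq// h.
by have := congr1 (fun l => nth (Z i w) l i) h; rewrite !nth_mkseq.
Qed.

Lemma hist_le n k w w' : (k <= n)%N -> hist n w = hist n w' ->
  hist k w = hist k w'.
Proof.
move=> kn /hist_eqP h; apply/hist_eqP => i ik; apply: h; exact: leq_trans kn.
Qed.

Lemma histS n w : hist n.+1 w = rcons (hist n w) (Z n w).
Proof. by rewrite /hist mkseqS. Qed.

Hypothesis Zmeas : forall n e, measurable [set w | Z n w = e].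

Lemma hist_measurable n h : measurable [set w | hist n w = h].
Proof.
elim: n h => [|n IH] h.
  case: h => [|e h]; first by rewrite (_ : mkset _ = setT)//; apply/seteqP; split.
  by rewrite (_ : mkset _ = set0)//; apply/seteqP; split.
case/lastP: h => [|h e].
  by rewrite (_ : mkset _ = set0)//; apply/seteqP; split => // w /=; rewrite histS;
    case: (hist n w).
rewrite (_ : mkset _ = [set w | hist n w = h] `&` [set w | Z n w = e]).
  exact: measurableI.
apply/seteqP; split => w /=; rewrite histS; first by move/rcons_inj => [].
by case=> -> ->.
Qed.

(** Words over a countable alphabet are countable, so an event decided by the first n symbols is a
    countable union of cylinders. Constancy on equal histories thus stands in for a filtration. *)
Lemma adapted_measurable n (A : set Omega) :
  (forall w w', hist n w = hist n w' -> A w -> A w') -> measurable A.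
Proof.
move=> hA.
rewrite (_ : A = \bigcup_(h : seq E) [set w | hist n w = h /\ A w]); last first.
  by apply/seteqP; split => [w Aw|w [h _ []]//]; exists (hist n w).
apply: countable_bigcupT_measurable => // h.
have [[w [wh Aw]]|no] := pselect (exists w, hist n w = h /\ A w).
  rewrite (_ : mkset _ = [set w | hist n w = h]); first exact: hist_measurable.
  apply/seteqP; split => [w' []//|w' /= w'h]; split => //.
  by apply: hA Aw; rewrite wh.
rewrite (_ : mkset _ = set0)//; apply/seteqP; split => // w wA.
by apply: no; exists w.
Qed.

Lemma adapted_exists_measurable (A : nat -> set Omega) :
  (forall n w w', hist n w = hist n w' -> A n w -> A n w') ->
  measurable [set w | exists n, A n w].
Proof.
move=> hA; rewrite (_ : mkset _ = \bigcup_n A n).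
  by apply: bigcupT_measurable => n; exact: adapted_measurable (hA n).
by apply/seteqP; split => [w [n An]|w [n _ An]]; exists n.
Qed.

Variables (mu : E -> R) (s : seq E).
Hypotheses (mu_ge0 : forall e, 0 <= mu e)
  (Zs : forall n, P [set w | Z n w \notin s] = 0%E)
  (Zlaw : forall h : seq E, {subset h <= s} ->
     P [set w | hist (size h) w = h] = (\prod_(e <- h) mu e)%:E).

(* Ville's inequality for a product of likelihood-type ratios whose shape at each
   step ([mode]) is a function of the past symbols. *)
Section Ville.
Variables (A : Type) (mode : nat -> Omega -> A) (r : A -> E -> R).
Hypotheses (mode_adapted : forall n w w', hist n w = hist n w' -> mode n w = mode n w')
  (r_ge0 : forall a e, 0 <= r a e)
  (r_le1 : forall a, \sum_(e <- s) mu e * r a e <= 1).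

Definition mode_prod (n : nat) (w : Omega) : R :=
  \prod_(i < n) r (mode i w) (Z i w).

Lemma mode_prod_adapted n w w' :
  hist n w = hist n w' -> mode_prod n w = mode_prod n w'.
Proof.
move=> h; apply: eq_bigr => i _; rewrite (mode_adapted (hist_le (ltnW (ltn_ord i)) h)).
by move/hist_eqP : h => ->.
Qed.

Lemma mode_prod_ge0 n w : 0 <= mode_prod n w.
Proof. exact: prodr_ge0. Qed.

(** Optional stopping without conditional expectations: the bound is stated on the cylinder of the
    first k symbols of a sample point [w0], and the horizon n is the induction variable. On that
    cylinder the next ratio has a known shape, so [r_le1] is the supermartingale property. *)
Lemma ville_from n k w0 (x : R) : 0 < x -> {subset hist k w0 <= s} ->
  (P [set w | hist k w = hist k w0 /\
              exists i, (i <= n)%N /\ (x <= mode_prod (k + i)%N w)%R]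
   <= ((\prod_(e <- hist k w0) mu e) * (mode_prod k w0 / x))%:E)%E.
Proof.
move=> x0; elim: n k w0 => [|n IH] k w0 w0s.
all: set B := mkset _.
all: have B0 : 0 <= (\prod_(e <- hist k w0) mu e) * (mode_prod k w0 / x)
  by rewrite mulr_ge0 ?prodr_ge0 ?divr_ge0 ?mode_prod_ge0 ?ltW.
all: have [xL|Lx] := leP x (mode_prod k w0).
all: have szk : size (hist k w0) = k by rewrite size_mkseq.
all: have mB m : measurable [set w | hist k w = hist k w0 /\
   exists i, (i <= m)%N /\ x <= mode_prod (k + i)%N w]
  by apply: (@adapted_measurable (k + m)) => w w' ww' [wh [i [im xi]]]; split;
     [rewrite -wh; apply/esym/(hist_le _ ww'); exact: leq_addr
     |exists i; split => //; rewrite -(mode_prod_adapted (hist_le _ ww')) ?leq_add2l].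
(* If the level is already reached at time k, in the base case or in the induction step, the
   right-hand side is at least the probability of the whole cylinder. *)
1,3: apply: (@le_trans _ _ (P [set w | hist k w = hist k w0]));
  [apply: le_measure; rewrite ?inE;
     [exact: mB| exact: hist_measurable|by move=> w []]|];
  rewrite -{1}szk Zlaw// lee_fin ler_peMr ?prodr_ge0//; by rewrite ler_pdivlMr ?mul1r.
  rewrite (_ : B = set0) ?measure0 ?lee_fin//.
  apply/seteqP; split => // w [wh [i []]]; rewrite leqn0 => /eqP->.
  by rewrite addn0 (mode_prod_adapted wh) leNgt Lx.
(* Split by the next symbol. Since the level is not reached at time k itself, it must be reached
   from time k + 1 on, with horizon n. *)
pose C e := [set w | hist k.+1 w = rcons (hist k w0) e /\
              exists i, (i <= n)%N /\ x <= mode_prod (k.+1 + i)%N w].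
have mC e : measurable (C e).
  apply: (@adapted_measurable (k.+1 + n)) => w w' ww' [wh [i [im xi]]]; split.
    by rewrite -wh; apply/esym/(hist_le _ ww'); exact: leq_addr.
  by exists i; split => //; rewrite -(mode_prod_adapted (hist_le _ ww')) ?leq_add2l.
have mN : measurable [set w | Z k w \notin s].
  apply: (@adapted_measurable k.+1) => w w' /hist_eqP /(_ k (ltnSn k)) /=.
  by move=> ->.
apply: (@le_trans _ _ (P ([set w | Z k w \notin s] `|` \big[setU/set0]_(e <- s) C e))).
  apply: le_measure; rewrite ?inE; [exact: mB| |].
    by apply: measurableU => //; exact: bigsetU_measurable.
  move=> w [wh [i [im xi]]]; have [Zk|Zk] := boolP (Z k w \in s); last by left.
  right; rewrite -bigcup_seq; exists (Z k w) => //; split.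
    by rewrite histS wh.
  case: i im xi => [|i] im xi.
    by move: xi; rewrite addn0 (mode_prod_adapted wh) leNgt Lx.
  by exists i; split => //; rewrite addSnnS.
apply: le_trans (measureU2 _ _ _) _ => //; first exact: bigsetU_measurable.
rewrite -[leRHS]add0e; apply: leeD; first by rewrite -(Zs k).
apply: le_trans (measure_bigsetU_le P s mC) _.
pose a0 := mode k w0.
apply: (@le_trans _ _ (\sum_(e <- s) ((\prod_(e <- hist k w0) mu e) * (mode_prod k w0 / x) *
   (mu e * r a0 e))%:E)%E); last first.
  rewrite sumEFin lee_fin -mulr_sumr ler_piMr//.
rewrite big_seq [leRHS]big_seq; apply: lee_sum => e es.
(* The induction hypothesis needs a sample point in the longer cylinder, so an empty [C e] is
   treated apart. *)
have [[w1 [w1h w1x]]|no] := pselect (exists w, C e w); last first.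
  rewrite (_ : C e = set0); first by rewrite measure0 lee_fin mulr_ge0// mulr_ge0.
  by apply/seteqP; split => // w wC; apply: no; exists w.
have [h1 h2] : hist k w1 = hist k w0 /\ Z k w1 = e.
  by move: w1h; rewrite histS => /rcons_inj[].
have -> : C e = [set w | hist k.+1 w = hist k.+1 w1 /\
              exists i, (i <= n)%N /\ x <= mode_prod (k.+1 + i)%N w].
  by rewrite /C w1h.
apply: le_trans (IH _ _ _) _.
  by rewrite w1h => e'; rewrite mem_rcons inE => /orP[/eqP->//|/w0s].
rewrite lee_fin w1h -cats1 big_cat big_seq1/= /mode_prod big_ord_recr/=.
rewrite -!/(mode_prod _ _) (mode_prod_adapted h1) (mode_adapted h1) h2 -/a0.
rewrite [leLHS](_ : _ = (\prod_(e <- hist k w0) mu e) * (mode_prod k w0 / x) * (mu e * r a0 e))//; ring.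
Qed.

Lemma ville (x : R) : 0 < x ->
  (P [set w | exists n, (x <= mode_prod n w)%R] <= (x^-1)%:E)%E.
Proof.
move=> x0.
pose F n := [set w | exists i, (i <= n)%N /\ x <= mode_prod i w].
have mF n : measurable (F n).
  apply: (@adapted_measurable n) => w w' ww' [i [im xi]].
  by exists i; split => //; rewrite -(mode_prod_adapted (hist_le _ ww')).
have FE : [set w | exists n, x <= mode_prod n w] = \bigcup_n F n.
  apply/seteqP; split => [w [n xn]|w [n _ [i [_ xi]]]]; last by exists i.
  by exists n => //; exists n.
have ndF : nondecreasing_seq F.
  move=> m n mn; apply/subsetPset => w [i [im xi]]; exists i; split => //.
  exact: leq_trans mn.
have cv : P (F n) @[n --> \oo] --> P (\bigcup_n F n).
  by apply: nondecreasing_cvg_mu => //; exact: bigcup_measurable.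
rewrite FE -(cvg_lim _ cv)//; apply: lime_le; first by apply/cvg_ex; exists (P (\bigcup_n F n)).
(* At length zero every sample point has the empty history, so the base point is arbitrary. *)
near=> n => /=; have := @ville_from n 0 point x x0.
rewrite /hist /= big_nil {2}/mode_prod big_ord0 !mul1r => /(_ _)/=.
move=> h; apply: le_trans (h _); last by [].
apply: le_measure; rewrite ?inE//.
  by have := mF n; congr measurable; apply/seteqP; split => [w [i [im xi]]|w [_ [i [im xi]]]];
    [split => //; exists i|exists i].
Unshelve. all: by end_near. Qed.

End Ville.

(** The product of the tilted factors exp(t g + k) gains k per step, so a nonnegative sum at any
    time after n lifts it above exp(k n). The maximal inequality then covers all these times at
    once, with no union bound. *)
Lemma large_deviation (g : E -> R) (B dl : R) :
  \sum_(e <- s) mu e = 1 -> 0 < dl -> {in s, forall e, `|g e| <= B} ->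
  \sum_(e <- s) mu e * g e <= - dl ->
  exists rho : R, [/\ 0 < rho, rho < 1 & forall n,
    (P [set w | exists k, (n <= k)%N /\ (0 <= \sum_(i < k) g (Z i w))%R]
      <= (rho ^+ n)%:E)%E].
Proof.
move=> mu1 dl0 gB gd.
have [t [k [t0 k0 tk]]] := exponential_tilt mu_ge0 mu1 dl0 gB gd.
exists (expR (- k)); split => [||n]; first exact: expR_gt0.
  by rewrite -expR0 ltr_expR oppr_lt0.
pose r (_ : unit) e := expR (t * g e + k).
have := @ville unit (fun _ _ => tt) r (fun _ _ _ _ => erefl)
  (fun _ _ => expR_ge0 _) (fun _ => tk) (expR (k * n%:R)) (expR_gt0 _).
have -> : (expR (k * n%:R))^-1 = expR (- k) ^+ n :> R.
  by rewrite -expRN -mulNr mulrC expRM_natl.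
apply: le_trans.
apply: le_measure; rewrite ?inE.
- apply: adapted_exists_measurable => m w w' /hist_eqP ww' [nm h]; split => //.
  by under eq_bigr do rewrite -ww'//.
- apply: adapted_exists_measurable => m w w' ww'.
  by rewrite (@mode_prod_adapted _ (fun _ _ => tt) r (fun _ _ _ _ => erefl) _ _ _ ww').
move=> w [m [nm h]]; exists m.
rewrite /mode_prod -expR_sum ler_expR big_split/= -mulr_sumr sumr_const card_ord.
rewrite -[k *+ m]mulr_natr; apply: (@le_trans _ _ (k * m%:R)).
  by rewrite ler_pM2l// ler_nat.
by rewrite lerDr mulr_ge0// ltW.
Qed.

End AdaptedProcess.

(** * Uniform control of finitely many random walks *)

Section UniformDeviation.
Context {R : realType} {d : measure_display} {Omega : measurableType d}
        (P : probability Omega R) {E : countType} (Z : nat -> Omega -> E).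
Hypothesis Zmeas : forall n e, measurable [set w | Z n w = e].
Variables (mu : E -> R) (s : seq E).
Hypotheses (mu_ge0 : forall e, 0 <= mu e)
  (Zs : forall n, P [set w | Z n w \notin s] = 0%E)
  (Zlaw : forall h : seq E, {subset h <= s} ->
     P [set w | hist Z (size h) w = h] = (\prod_(e <- h) mu e)%:E).
Variables (I : finType) (g : I -> E -> R) (mean : I -> R).

(** The complement says that the last exit from all cones happens before n. Leaving [s] is included
    so that, on the complement, every bound valid on [s] holds at every time. *)
Definition deviates (dl : R) (n : nat) : set Omega :=
  [set w | (exists k, Z k w \notin s) \/
     exists k, (n <= k)%N /\
       exists i, dl * k%:R < `|\sum_(j < k) g i (Z j w) - mean i * k%:R|].

Let leaves_measurable : measurable [set w | exists k, Z k w \notin s].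
Proof.
rewrite (_ : mkset _ = \bigcup_k [set w | Z k w \notin s]).
  apply: bigcupT_measurable => k; apply: (@adapted_measurable _ _ _ _ Zmeas k.+1).
  by move=> w w' /hist_eqP /(_ k (ltnSn k)) /= ->.
by apply/seteqP; split => [w [k h]|w [k _ h]]; exists k.
Qed.

Lemma deviates_measurable dl n : measurable (deviates dl n).
Proof.
apply: measurableU => //; apply: adapted_exists_measurable => //.
move=> k w w' /hist_eqP ww' [nk [i h]]; split => //; exists i.
by under eq_bigr do rewrite -ww'//.
Qed.

(** Leaving a cone on one side means that a walk with steps of mean -dl is nonnegative. There are
    two such walks per index, one for each sign, and the slowest of their rates serves for all. *)
Lemma deviates_le (B dl : R) :
  \sum_(e <- s) mu e = 1 -> 0 < dl ->
  (forall i, {in s, forall e, `|g i e| <= B}) ->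
  (forall i, \sum_(e <- s) mu e * g i e = mean i) ->
  exists C rho : R, [/\ 0 <= C, 0 < rho, rho < 1 &
    forall n, (P (deviates dl n) <= (C * rho ^+ n)%:E)%E].
Proof.
move=> mu1 dl0 gB gm.
pose gg (ib : I * bool) e := (-1) ^+ ib.2 * (g ib.1 e - mean ib.1) - dl.
have ld ib : exists rho : R, [/\ 0 < rho, rho < 1 & forall n,
    (P [set w | exists k, (n <= k)%N /\ (0 <= \sum_(i < k) gg ib (Z i w))%R]
      <= (rho ^+ n)%:E)%E].
  apply: (large_deviation Zmeas mu_ge0 Zs Zlaw (B := B + `|mean ib.1| + dl) mu1 dl0).
    move=> e es; rewrite /gg; apply: le_trans (ler_normB _ _) _.
    rewrite (gtr0_norm dl0) lerD2r normrM normrX normrN1 expr1n mul1r.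
    by apply: le_trans (ler_normB _ _) _; rewrite lerD2r; exact: gB.
  rewrite /gg (eq_bigr (fun e => (-1) ^+ ib.2 * (mu e * g ib.1 e) -
    ((-1) ^+ ib.2 * mean ib.1 + dl) * mu e)); last by move=> e _; ring.
  rewrite sumrB -!mulr_sumr mu1 gm; lra.
have [rho rhoP] := choice ld.
(* The default 1/2 keeps the rate strictly between 0 and 1 even over an empty index type. *)
pose r := \big[Num.max/1 / 2]_(ib : I * bool) rho ib.
have r0 : 0 < r by apply: lt_le_trans (bigmax_ge_id _ _ _ _); lra.
exists (#|{: I * bool}|%:R), r; split => //.
  apply: bigmax_lt => [|ib _]; first lra.
  by have [] := rhoP ib.
move=> n.
pose F ib := [set w | exists k, (n <= k)%N /\ 0 <= \sum_(i < k) gg ib (Z i w)].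
have mF ib : measurable (F ib).
  apply: adapted_exists_measurable => // k w w' /hist_eqP ww' [nk h]; split => //.
  by under eq_bigr do rewrite -ww'//.
apply: (@le_trans _ _ (P ([set w | exists k, Z k w \notin s] `|`
    \big[setU/set0]_(ib <- enum [the finType of (I * bool)%type]) F ib))).
  apply: le_measure; rewrite ?inE.
  - exact: deviates_measurable.
  - by apply: measurableU => //; exact: bigsetU_measurable.
  move=> w [h|[k [nk [i h]]]]; [by left|right].
  rewrite -bigcup_seq /=.
  have S b : \sum_(j < k) gg (i, b) (Z j w) =
      (-1) ^+ b * (\sum_(j < k) g i (Z j w) - mean i * k%:R) - dl * k%:R.
    rewrite /gg/= sumrB -mulr_sumr sumrB !sumr_const card_ord !mulr_natr; ring.
  have [a0|a0] := leP 0 (\sum_(j < k) g i (Z j w) - mean i * k%:R).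
    exists (i, false); first by rewrite /= mem_enum.
    exists k; split => //; rewrite S expr0 mul1r.
    by move: h; rewrite ger0_norm// => h; rewrite subr_ge0 ltW.
  exists (i, true); first by rewrite /= mem_enum.
  exists k; split => //; rewrite S expr1 mulN1r.
  by move: h; rewrite ltr0_norm// => h; rewrite subr_ge0 ltW.
apply: le_trans (measureU2 _ _ _) _ => //; first exact: bigsetU_measurable.
rewrite -[leRHS]add0e; apply: leeD.
  rewrite (_ : mkset _ = \bigcup_k [set w | Z k w \notin s]); last first.
    by apply/seteqP; split => [w [k h]|w [k _ h]]; exists k.
  have mk k : measurable [set w | Z k w \notin s].
    apply: (@adapted_measurable _ _ _ _ Zmeas k.+1).
    by move=> w w' /hist_eqP /(_ k (ltnSn k)) /= ->.
  apply: le_trans (generalized_Boole_inequality _ _ _) _ => //.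
    exact: bigcupT_measurable.
  by rewrite eseries0// => k _ _; exact: Zs.
apply: le_trans (measure_bigsetU_le P _ mF) _.
rewrite mulr_natl -sumr_const -sumEFin big_enum/=.
apply: lee_sum => ib _; have [r1 r2 h] := rhoP ib.
have rr : rho ib <= r by exact: le_bigmax.
by apply: le_trans (h n) _; rewrite lee_fin lerXn2r// nnegrE ltW.
Qed.

End UniformDeviation.

(** * Expectations from geometric tails *)

Section IntegralBounds.
Context {R : realType} {d : measure_display} {Omega : measurableType d}
        (P : probability Omega R).
Implicit Types (f N : Omega -> \bar R).

(* No measurability is needed: both integrals are suprema over the simple
   functions below the integrand. *)
Lemma ge0_integral_mono f g : (forall w, 0 <= f w)%E ->
  (forall w, f w <= g w)%E -> (\int[P]_w f w <= \int[P]_w g w)%E.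
Proof.
move=> f0 fg; rewrite !ge0_integralTE//; last by move=> w; apply: le_trans (fg w).
by apply: le_ereal_sup => _ [h hf <-]; exists h => // w; apply: le_trans (fg w).
Qed.

Lemma ge0_integral_ge_cst N (A : set Omega) (a : R) : measurable A -> 0 <= a ->
  (forall w, 0 <= N w)%E -> (forall w, A w -> a%:E <= N w)%E ->
  (a%:E * P A <= \int[P]_w N w)%E.
Proof.
move=> mA a0 N0 aN; rewrite -[A]setIT -(integral_indic P measurableT mA).
rewrite -ge0_integralZl_EFin//; last first.
  by apply/measurable_EFinP; exact: measurable_realfun.measurable_indic.
apply: ge0_integral_mono => w; first by rewrite mule_ge0// lee_fin.
rewrite indicE; case: (asboolP (w \in A)).
  by move=> wA; rewrite wA mule1; apply: aN; rewrite inE in wA.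
by move/negP/negbTE => ->; rewrite mule0.
Qed.

(** The last exit time is never constructed. The number of bad indices, [sig], dominates the least
    good index, is measurable as a sum of indicators, and has mean at most C / (1 - rho). The
    constant V is chosen before N, a and b, so one V works for all values of c. *)
Lemma integral_le_of_tail (bad : nat -> set Omega) (C rho : R) :
  (forall n, measurable (bad n)) -> 0 <= C -> 0 < rho -> rho < 1 ->
  (forall n, (P (bad n) <= (C * rho ^+ n)%:E)%E) ->
  exists V : R, 0 <= V /\ forall N (a b : R), 0 <= a -> 0 < b ->
    (forall w, 0 <= N w)%E ->
    (forall n w, ~ bad n w -> (N w <= (a + b * n%:R)%:E)%E) ->
    (\int[P]_w N w <= (a + b * V)%:E)%E.
Proof.
move=> mbad C0 r0 r1 Pbad; exists (C / (1 - rho)).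
split; first by rewrite divr_ge0// subr_ge0 ltW.
move=> N a b a0 b0 N0 Nle.
pose f n w : \bar R := (\1_(bad n) w)%:E.
have f0 n w : (0 <= f n w)%E by rewrite lee_fin.
have mf n : measurable_fun setT (f n).
  by apply/measurable_EFinP; exact: measurable_realfun.measurable_indic.
pose sig w := (\sum_(0 <= n <oo) f n w)%E.
have sig0 w : (0 <= sig w)%E by exact: nneseries_ge0.
have msig : measurable_fun setT sig.
  by apply: ge0_emeasurable_sum.
apply: (@le_trans _ _ (\int[P]_w (a%:E + b%:E * sig w))%E).
  apply: ge0_integral_mono => // w.
  have count n : (forall k, (k < n)%N -> bad k w) -> (n%:R%:E <= sig w)%E.
    move=> h; apply: le_trans (nneseries_lim_ge n _) => //.
    rewrite big_mkord sumEFin lee_fin (eq_bigr (fun=> 1)).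
      by rewrite sumr_const card_ord.
    by move=> i _; rewrite indicE mem_set//; exact: h.
  have [ex|no] := pselect (exists n, `[< ~ bad n w >]).
    case: (ex_minnP ex) => m /asboolP mb mmin.
    apply: le_trans (Nle _ _ mb) _; rewrite EFinD EFinM; apply: leeD2l.
    apply: lee_wpmul2l; first by rewrite lee_fin ltW.
    apply: count => k km; apply: contrapT => /asboolP/mmin.
    by rewrite leqNgt km.
  rewrite (_ : sig w = +oo%E); first by rewrite gt0_muley ?lte_fin// addey// leey.
  apply/eqyP => A A0; apply: (@le_trans _ _ ((Num.truncn A).+1%:R%:E)).
    by rewrite lee_fin ltW// truncnS_gt.
  by apply: count => k _; apply: contrapT => /asboolP kb; apply: no; exists k.
rewrite ge0_integralD//; last 2 first.
- by move=> w _; rewrite mule_ge0// lee_fin ltW.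
- exact: measurable_funeM.
rewrite (integral_cst P measurableT a%:E) [X in (_ * X + _)%E](probability_setT P) mule1 EFinD.
apply: leeD2l.
rewrite (ge0_integralZl_EFin P measurableT (fun w _ => sig0 w) msig (ltW b0)) EFinM.
have b0' : (0 <= b%:E)%E by rewrite lee_fin ltW.
apply: (lee_wpmul2l b0').
rewrite integral_nneseries//.
apply: lime_le.
  by apply: is_cvg_nneseries => k _ _; apply: integral_ge0.
apply: nearW => n.
apply: (@le_trans _ _ (\sum_(0 <= k < n) (C * rho ^+ k)%:E)%E).
  by apply: lee_sum => k _; rewrite /f integral_indic// setIT; exact: Pbad.
rewrite sumEFin lee_fin; apply: le_trans (geometric_le_lim n C0 r0 _).
  by rewrite /series/=.
by rewrite gtr0_norm.
Qed.

End IntegralBounds.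

(** * A fixed sample path of the two-stage test *)

(* [S a m' n] is the log-likelihood ratio of [m] against [m'] after [n] messages
   produced by family [a] ([None] is the first stage), [I a m'] its drift; after
   time [s] the path stays within [dl * n] of the drift.  [lam] and [ell] stand
   for [|log u|] and [|log c|]. *)
Section StoppingPath.
Context {R : realType} {M : nat} (m : 'I_M).
Variables (S : option 'I_M -> 'I_M -> nat -> R) (I : option 'I_M -> 'I_M -> R)
  (B C0 C1 Im Is dl lam ell : R) (s : nat)
  (N0 : option nat) (D0 : option 'I_M) (N : option nat).

(** The evidence the test has really accumulated at time n. It is written with walks started at zero
    because only those obey the cone bounds. *)
Let LL n0 k m' n := S None m' n0 + (S (Some k) m' n - S (Some k) m' n0).

Hypotheses (C0_ge0 : 0 <= C0) (lam_gt0 : 0 < lam) (ell_gt0 : 0 < ell)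
  (S_le : forall a m' n, `|S a m' n| <= B * n%:R)
  (S_dev : forall a m' n, (s <= n)%N -> `|S a m' n - I a m' * n%:R| <= dl * n%:R)
  (Is_gt0 : 0 < Is) (dl_gt0 : 0 < dl) (dl_le : dl <= Is / 2)
  (I_ge : forall a (m' : 'I_M), m' != m -> Is <= I a m')
  (Im_le : forall m' : 'I_M, m' != m -> Im <= I (Some m) m') (Is_Im : Is <= Im)
  (N0_le : forall n, (forall m' : 'I_M, m' != m -> lam + C0 <= S None m' n) ->
     exists2 n0, N0 = Some n0 & (n0 <= n)%N)
  (D0_spec : forall n0, N0 = Some n0 ->
     exists2 k : 'I_M, D0 = Some k & (k != m -> S None k n0 <= - lam + C1))
  (N_le : forall n0 k n, N0 = Some n0 -> D0 = Some k -> (n0 <= n)%N ->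
     (forall m' : 'I_M, m' != m -> ell + C0 <= LL n0 k m' n) ->
     exists2 n', N = Some n' & (n' <= n)%N)
  (N_spec : forall n0 k n, N0 = Some n0 -> D0 = Some k -> N = Some n ->
     (n0 <= n)%N /\ ((forall m' : 'I_M, m' != m -> ell - C1 <= LL n0 k m' n) \/
                     exists2 k' : 'I_M, k' != m & LL n0 k k' n <= - ell + C1)).

Let constants_order :
  [/\ 0 <= C0, 0 < lam, 0 < ell & [/\ 0 < Is, 0 < dl, dl <= Is / 2 & Is <= Im]].
Proof. by []. Qed.

(** Since dl <= Is / 2, every walk grows at least at speed [h] inside its cone. [n1max] is the wait
    for the cone plus the climb to lam + C0 at that speed, plus one for rounding. *)
Let h := Is / 2.
Let n1max : R := s%:R + ((lam + C0) / h + 1).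

Let h_gt0 : 0 < h. Proof. by rewrite divr_gt0. Qed.

Let S_bounds a m' n : - (B * n%:R) <= S a m' n <= B * n%:R.
Proof. by rewrite -ler_norml. Qed.

Let S_dev_bounds a m' n : (s <= n)%N ->
  (I a m' - dl) * n%:R <= S a m' n <= (I a m' + dl) * n%:R.
Proof.
move=> /(S_dev a m'); rewrite ler_norml => /andP[h1 h2].
by rewrite mulrBl mulrDl; lra.
Qed.

Let S_ge a (m' : 'I_M) n (g : R) : m' != m -> (s <= n)%N -> g <= I a m' - dl ->
  g * n%:R <= S a m' n.
Proof.
move=> m'm sn gI; have /andP[h1 _] := S_dev_bounds a m' sn.
by apply: le_trans h1; rewrite ler_wpM2r.
Qed.

Let truncn_step (x : R) : 0 <= x -> x <= (Num.truncn x).+1%:R <= x + 1.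
Proof.
move=> x0; rewrite ltW ?truncnS_gt//= -natr1 lerD2r.
by move/truncn_itv : x0 => /andP[].
Qed.

Lemma first_stage_bound :
  exists2 n0, N0 = Some n0 & n0%:R <= n1max.
Proof.
have [l1 l2 l3 [l4 l5 l6 l7]] := constants_order.
have x0 : 0 <= (lam + C0) / h by rewrite divr_ge0 ?addr_ge0// ltW.
have /andP[t1 t2] := truncn_step x0.
pose n1 := (s + (Num.truncn ((lam + C0) / h)).+1)%N.
have [|n0 N0E n01] := @N0_le n1.
  move=> m' m'm; apply: le_trans (@S_ge None m' n1 h m'm _ _).
  - move: t1; rewrite ler_pdivrMr// mulrC => t1; apply: le_trans t1 _.
    by rewrite ler_pM2l// ler_nat leq_addl.
  - exact: leq_addr.
  - by have := I_ge None m'm; rewrite /h; lra.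
exists n0 => //; apply: (@le_trans _ _ n1%:R); first by rewrite ler_nat.
by rewrite natrD /n1max lerD2l.
Qed.

(* A wrong first-stage decision forces a large value of [s]: this converts the
   probability of a wrong decision into the expectation of [s]. *)
Lemma wrong_first_stage n0 (k : 'I_M) : N0 = Some n0 -> D0 = Some k -> k != m ->
  C1 < lam -> lam - C1 <= B * s%:R.
Proof.
have [l1 l2 l3 [l4 l5 l6 l7]] := constants_order.
move=> N0E D0E km C1l; have [k' ] := D0_spec N0E.
rewrite D0E => -[<-] /(_ km) Sk.
(* From time s on the walk against [k] is nonnegative, whereas a wrong decision needs it below -lam
   + C1 < 0. *)
have n0s : (n0 < s)%N.
  rewrite ltnNge; apply/negP => sn0.
  have := @S_ge None k n0 0 km sn0; rewrite mul0r => /(_ _).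
  by have := I_ge None km; move=> h1 h2; have := h2 _; lra.
have /andP[h1 _] := S_bounds None k n0.
have B0 : 0 <= B by have := S_le None k 1; rewrite mulr1; apply: le_trans.
have : B * n0%:R <= B * s%:R by rewrite ler_wpM2l// ler_nat ltnW.
lra.
Qed.

Let B_ge0 : 0 <= B.
Proof. by have := S_le None m 1; rewrite mulr1; apply: le_trans. Qed.

(** After a correct first stage the speed is Im - dl. After a wrong one only [h] is guaranteed, and
    the ell / h steps are charged to s through 1 <= B s / (lam - C1). The result is affine in s, as
    [integral_le_of_tail] requires. *)
Lemma total_time_upper : C1 < lam ->
  exists2 n, N = Some n &
  n%:R <= ((1 + 2 * B / h) * ((lam + C0) / h + 1) + C0 / h + 1 + ell / (Im - dl))
        + ((1 + 2 * B / h) + 1 + ell * B / (h * (lam - C1))) * s%:R.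
Proof.
have [l1 l2 l3 [l4 l5 l6 l7]] := constants_order.
move=> C1l; have [n0 N0E n0le] := first_stage_bound.
have [k D0E _] := D0_spec N0E.
have main g : h <= g -> (forall m' : 'I_M, m' != m -> g <= I (Some k) m' - dl) ->
    exists2 n, N = Some n &
      n%:R <= n0%:R * (1 + 2 * B / h) + s%:R + C0 / h + 1 + ell / g.
  move=> hg gI; have g0 : 0 < g by apply: lt_le_trans hg.
  (* The height the walk of family [k], started at zero, must reach: one B n0 covers a loss during
     the first stage, the other the value of this walk at n0, which is subtracted. *)
  pose y := ell + C0 + 2 * B * n0%:R.
  have y0 : 0 <= y / g by rewrite divr_ge0 ?(ltW g0)// !addr_ge0 ?mulr_ge0// ltW.
  have /andP[t1 t2] := truncn_step y0.
  pose n2 := (n0 + s + (Num.truncn (y / g)).+1)%N.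
  have [||n NE nle] := @N_le n0 k n2 N0E D0E.
  - by rewrite /n2 -addnA leq_addr.
  - move=> m' m'm; rewrite /LL.
    have /andP[b1 _] := S_bounds None m' n0.
    have /andP[_ b2] := S_bounds (Some k) m' n0.
    have := @S_ge (Some k) m' n2 g m'm _ (gI _ m'm).
    rewrite /n2 addnAC leq_addl => /(_ isT) b3.
    have : y <= g * (n0 + (Num.truncn (y / g)).+1 + s)%:R.
      move: t1; rewrite ler_pdivrMr// mulrC => t1; apply: le_trans t1 _.
      by rewrite ler_pM2l// ler_nat addnAC leq_addl.
    by rewrite /y; lra.
  exists n => //; apply: (@le_trans _ _ n2%:R); first by rewrite ler_nat.
  have yE : y / g = ell / g + C0 / g + 2 * B * n0%:R / g by rewrite /y; ring.
  rewrite !natrD; move: t2; rewrite [X in _ <= X + 1]yE => t2.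
  have c0 : C0 / g <= C0 / h by rewrite ler_wpM2l// lef_pV2.
  have c1 : 2 * B * n0%:R / g <= 2 * B * n0%:R / h.
    by rewrite ler_wpM2l ?mulr_ge0// lef_pV2.
  rewrite (_ : n0%:R * (1 + 2 * B / h) = n0%:R + 2 * B * n0%:R / h); last by ring.
  lra.
have n0c : n0%:R * (1 + 2 * B / h) <=
    (s%:R + ((lam + C0) / h + 1)) * (1 + 2 * B / h).
  by rewrite ler_wpM2r// addr_ge0// divr_ge0 ?mulr_ge0// ltW.
have lC : 0 < lam - C1 by lra.
have b0 : 0 <= ell * B / (h * (lam - C1)) * s%:R.
  by rewrite mulr_ge0// divr_ge0 ?mulr_ge0// ltW.
have [km|km] := eqVneq k m.
  have [||n NE nle] := main (Im - dl); first by rewrite /h; lra.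
    by move=> m' m'm; rewrite lerD2r km; exact: Im_le.
  exists n => //; apply: le_trans nle _.
  move: n0c b0; rewrite !mulrDl !mulrDr !mul1r !mulr1; lra.
have [||n NE nle] := main h; first by [].
  by move=> m' m'm; have := I_ge (Some k) m'm; rewrite /h; lra.
exists n => //; apply: le_trans nle _.
have sge := wrong_first_stage N0E D0E km C1l.
have : ell / h <= ell * B / (h * (lam - C1)) * s%:R.
  rewrite (_ : _ * s%:R = ell / h * (B * s%:R / (lam - C1))); last first.
    by field; rewrite !gt_eqF.
  apply: ler_peMr; first by rewrite divr_ge0 ?ltW.
  by rewrite ler_pdivlMr ?mul1r.
have : 0 <= ell / (Im - dl) by rewrite divr_ge0 ?ltW//; lra.
move: n0c b0; rewrite !mulrDl !mulrDr !mul1r !mulr1; lra.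
Qed.

(** A moderate s excludes a wrong first decision. A wrong final decision would need evidence below
    -ell + C1, but it never falls below -(2 B n1max + B s). So the evidence against the closest
    state [ms] must reach ell - C1, and it grows no faster than Im + dl apart from bounded terms. *)
Lemma total_time_lower (ms : 'I_M) n : ms != m -> I (Some m) ms = Im ->
  B * s%:R < lam - C1 -> 2 * B * n1max + B * s%:R < ell - C1 ->
  N = Some n ->
  (ell - C1 - 2 * B * n1max - B * s%:R) / (Im + dl) <= n%:R.
Proof.
have [l1 l2 l3 [l4 l5 l6 l7]] := constants_order.
move=> msm Ims hlam hell NE; have [n0 N0E n0le] := first_stage_bound.
have [k D0E _] := D0_spec N0E.
have Bs0 : 0 <= B * s%:R by rewrite mulr_ge0.
have km : k = m.
  apply/eqP/negPn/negP => km.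
  by have := wrong_first_stage N0E D0E km; lra.
subst k.
have Bn0 : B * n0%:R <= B * n1max by rewrite ler_wpM2l.
have [n0n [h1|[k' k'm]]] := N_spec N0E D0E NE; last first.
  rewrite /LL => h1.
  have /andP[b1 _] := S_bounds None k' n0.
  have /andP[_ b2] := S_bounds (Some m) k' n0.
  (* After s the walk is nonnegative; before s the crude bound on increments suffices. *)
  have b3 : - (B * s%:R) <= S (Some m) k' n.
    have [sn|ns] := leqP s n.
      have := @S_ge (Some m) k' n 0 k'm sn; rewrite mul0r.
      by have := I_ge (Some m) k'm; move=> h2 h3; have := h3 _; lra.
    have /andP[b3 _] := S_bounds (Some m) k' n.
    by apply: le_trans b3; rewrite lerN2 ler_wpM2l// ler_nat ltnW.
  lra.
have := h1 _ msm; rewrite /LL => {}h1.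
have /andP[_ b1] := S_bounds None ms n0.
have /andP[b2 _] := S_bounds (Some m) ms n0.
have Id : 0 < Im + dl by lra.
rewrite ler_pdivrMr// mulrC.
have b3 : S (Some m) ms n <= (Im + dl) * n%:R + B * s%:R.
  have [sn|ns] := leqP s n.
    by have /andP[_] := S_dev_bounds (Some m) ms sn; rewrite Ims; lra.
  have /andP[_ b3] := S_bounds (Some m) ms n.
  have : B * n%:R <= B * s%:R by rewrite ler_wpM2l// ler_nat ltnW.
  have : 0 <= (Im + dl) * n%:R by rewrite mulr_ge0// ltW.
  lra.
lra.
Qed.

End StoppingPath.

(** * Hitting times and posterior thresholds *)

Section FirstHit.
Variable Q : pred nat.

Lemma first_hitP n :
  first_hit Q = Some n <-> Q n /\ forall k, (k < n)%N -> ~~ Q k.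
Proof.
rewrite /first_hit; case: pselect => [ex|no]; last first.
  by split=> // -[Qn _]; exfalso; apply: no; exists n.
case: ex_minnP => k Qk kmin; split=> [[<-]|[Qn nmin]].
  by split => // j jk; apply/negP => /kmin; rewrite leqNgt jk.
congr Some; apply/eqP; rewrite eqn_leq kmin//= leqNgt.
by apply/negP => /nmin; rewrite Qk.
Qed.

Lemma first_hit_le n : Q n -> exists2 n', first_hit Q = Some n' & (n' <= n)%N.
Proof.
move=> Qn; rewrite /first_hit; case: pselect => [ex|no]; last first.
  by exfalso; apply: no; exists n.
by case: ex_minnP => k Qk kmin; exists k => //; exact: kmin.
Qed.

End FirstHit.

Section MaxPosterior.
Context {R : realType} {M : nat}.
Implicit Types (pi prior L : 'I_M -> R).

Lemma le_maxpost pi m : pi m <= maxpost pi.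
Proof. exact: le_bigmax. Qed.

Lemma argmaxpost_some pi : (0 < M)%N -> exists k, argmaxpost pi = Some k.
Proof.
move=> M0; rewrite /argmaxpost; case: pickP => [i _|/(_ (Ordinal M0))//].
by exists (Order.arg_max i xpredT pi).
Qed.

Lemma argmaxpost_ge pi k x : argmaxpost pi = Some k -> 0 < x ->
  x <= maxpost pi -> x <= pi k.
Proof.
rewrite /argmaxpost; case: pickP => // i _ [] <- x0 xm.
case: arg_maxP => // j _ jmax; rewrite leNgt; apply/negP => jx.
move: xm; rewrite leNgt => /negP; apply; apply: bigmax_lt => // m _.
by apply: le_lt_trans jx; exact: jmax.
Qed.

Variables (prior L : 'I_M -> R) (C0 : R).
Hypotheses (prior_gt0 : forall m, 0 < prior m) (prior_sum : \sum_(m < M) prior m = 1)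
  (prior_ge : forall m, expR (- C0) <= prior m) (L_gt0 : forall m, 0 < L m).

Let post m := prior m * L m / \sum_(m' < M) prior m' * L m'.

Lemma prior_le1 m : prior m <= 1.
Proof.
rewrite -prior_sum (bigD1 m)//= lerDl; apply: sumr_ge0 => i _; exact: ltW.
Qed.

(** The margin C0 absorbs the prior weight of [m]: each rival likelihood is at most c times the term
    of [m]. Averaging with the other priors, of total mass at most 1, leaves the posterior at least
    1 / (1 + c) >= 1 - c. *)
Lemma post_ge_of_llr m c : 0 < c ->
  (forall m', m' != m -> - ln c + C0 <= ln (L m / L m')) -> 1 - c <= post m.
Proof.
move=> c0 h.
have le1 m' : m' != m -> L m' <= c * (prior m * L m).
  move=> /h h0.
  have h1 : expR (- ln c + C0) <= L m / L m'.
    by rewrite -[leRHS]lnK ?posrE ?divr_gt0// ler_expR.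
  have : expR (- ln c + C0) * L m' <= L m by rewrite -ler_pdivlMr.
  rewrite expRD expRN lnK ?posrE// => h2.
  have e1 : expR C0 * expR (- C0) = 1 by rewrite -expRD subrr expR0.
  have -> : L m' = c * (expR (- C0) * (c^-1 * expR C0 * L m')).
    rewrite (_ : _ * _ = (c / c) * (expR C0 * expR (- C0)) * L m'); last by ring.
    by rewrite e1 divff ?gt_eqF// !mul1r.
  by rewrite ler_pM2l// ler_pM// ?expR_ge0 ?mulr_ge0 ?invr_ge0 ?ltW ?expR_gt0.
have A0 : 0 < prior m * L m by rewrite mulr_gt0.
have rest : \sum_(m' < M | m' != m) prior m' * L m' <= c * (prior m * L m).
  apply: (@le_trans _ _ (\sum_(m' < M | m' != m) prior m' * (c * (prior m * L m)))).
    by apply: ler_sum => m' m'm; rewrite ler_pM2l//; exact: le1.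
  rewrite -mulr_suml; apply: ler_piMl; first by rewrite mulr_ge0 ?ltW.
  move: prior_sum; rewrite (bigD1 m)//= => <-.
  by rewrite lerDr ltW.
have rest0 : 0 <= \sum_(m' < M | m' != m) prior m' * L m'.
  by apply: sumr_ge0 => i _; rewrite mulr_ge0 ?ltW.
rewrite /post (bigD1 m)//=; rewrite ler_pdivlMr; last by rewrite ltr_wpDr.
move: rest rest0 A0.
move: (\sum_(m' < M | _) _) (prior m * L m) => x y xle x0 y0.
have : 0 <= c * x by rewrite mulr_ge0// ltW.
rewrite mulrDr !mulrBl !mul1r; lra.
Qed.

(** A posterior of at least 1 - c >= 1/2 bounds the rival odds by 2 c. The extra 1 next to C0 pays
    for this factor, since 2 <= e. *)
Lemma llr_ge_of_post k k' c : k' != k -> 0 < c -> c <= 1 / 2 -> 1 - c <= post k ->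
  - ln c - (C0 + 1) <= ln (L k / L k').
Proof.
move=> k'k c0 c12; rewrite /post.
have P0 m : 0 < prior m * L m by rewrite mulr_gt0.
have S0 : 0 < \sum_(m' < M) prior m' * L m'.
  by rewrite (bigD1 k)//= ltr_wpDr//; apply: sumr_ge0 => i _; rewrite ltW.
rewrite ler_pdivlMr// => h.
have Sge : prior k * L k + prior k' * L k' <= \sum_(m' < M) prior m' * L m'.
  rewrite (bigD1 k)//= (bigD1 k')//= addrA lerDl.
  by apply: sumr_ge0 => i _; rewrite ltW.
have h2 : prior k' * L k' <= 2 * c * (prior k * L k).
  move: h Sge (P0 k) (P0 k') S0.
  move: (\sum_(m' < M) _) (prior k * L k) (prior k' * L k') => x y z h Sge y0 z0 x0.
  have h3 : z <= c * x by move: h; rewrite mulrBl mul1r; lra.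
  have h4 : x <= 2 * y.
    have : c * x <= 1 / 2 * x by rewrite ler_wpM2r// ltW.
    by move: h; rewrite mulrBl mul1r; lra.
  apply: le_trans h3 _; rewrite (mulrC 2 c) -mulrA ler_pM2l//.
rewrite -ler_expR lnK ?posrE ?divr_gt0// ler_pdivlMr//.
rewrite opprD addrA expRD expRD expRN lnK ?posrE//.
have e2 : 2 * expR (-1) <= 1 :> R.
  have h1 := @expR_ge1Dx R 1; have h3 : 2 <= expR 1 :> R by lra.
  have h4 : expR 1 * expR (-1) = 1 :> R by rewrite -expRD subrr expR0.
  by rewrite -[leRHS]h4 ler_pM2r ?expR_gt0.
have h5 : expR (- C0) * L k' <= prior k' * L k' by rewrite ler_pM2r.
have h6 : prior k * L k <= L k by rewrite ler_piMl ?prior_le1// ltW.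
have h7 : expR (- C0) * L k' <= 2 * c * L k.
  apply: le_trans h5 _; apply: le_trans h2 _.
  by rewrite ler_pM2l// mulr_gt0.
rewrite (_ : _ * L k' = c^-1 * expR (-1) * (expR (- C0) * L k')); last by ring.
apply: (@le_trans _ _ (c^-1 * expR (-1) * (2 * c * L k))).
  by rewrite ler_pM2l// mulr_gt0 ?invr_gt0 ?expR_gt0.
rewrite (_ : c^-1 * _ * _ = (c / c) * (2 * expR (-1)) * L k); last by ring.
by rewrite divff ?gt_eqF// mul1r ler_piMl// ltW.
Qed.

End MaxPosterior.

(** * The posterior process as a function of the symbols *)

Section Model.
Context {R : realType} {d : measure_display} {Omega : measurableType d}
        {T : Type} {M : nat}.
Variables (P : 'I_M -> probability Omega R) (X : nat -> Omega -> T)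
          (prior : 'I_M -> R) (phi0 : T -> bool) (phi : 'I_M -> nat -> T -> bool)
          (J : 'I_M -> nat -> Omega -> nat).

(* The first-stage quantizer [phi0] is treated as one more randomized family,
   indexed by [None] and always selecting index [0]. *)
Definition qfam (a : option 'I_M) (i : nat) : T -> bool :=
  if a is Some k then phi k i else phi0.

Definition Jfam (a : option 'I_M) (n : nat) (w : Omega) : nat :=
  if a is Some k then J k n w else 0%N.

Definition symbol : countType := {ffun option 'I_M -> nat * bool}.

(* All the messages the sensor could send at time [n], whichever family is in use. *)
Definition Zsym (n : nat) (w : Omega) : symbol :=
  [ffun a => (Jfam a n w, qfam a (Jfam a n w) (X n w))].

Definition lik (m : 'I_M) (a : option 'I_M) (e : symbol) : R :=
  qprob P X m (qfam a (e a).1) (e a).2.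

Local Notation hist := (hist Zsym).
Local Notation posterior := (posterior P X prior).

Section Mode.
Variables (mode : nat -> Omega -> option 'I_M) (q : nat -> Omega -> T -> bool).
Hypothesis q_mode : forall n w, q n w = qfam (mode n w) (Jfam (mode n w) n w).

Lemma posteriorS n w : posterior q n.+1 w =
  bayes_update (posterior q n w) (fun m => lik m (mode n w) (Zsym n w)).
Proof.
rewrite /=; congr bayes_update; apply/funext => m.
by rewrite /lik /Zsym ffunE /= q_mode.
Qed.

Lemma posterior_adapted n w w' : hist n w = hist n w' ->
  (forall i, (i < n)%N -> mode i w = mode i w') ->
  posterior q n w = posterior q n w'.
Proof.
elim: n => [//|n IH] hw mw; rewrite !posteriorS IH; last 2 first.
- exact: hist_le hw.
- by move=> i ni; apply: mw; exact: ltnW.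
by rewrite mw//; move/hist_eqP : hw => ->.
Qed.

Definition likprod (n : nat) (w : Omega) (m : 'I_M) : R :=
  \prod_(i < n) lik m (mode i w) (Zsym i w).

Hypotheses (prior_gt0 : forall m, 0 < prior m) (prior_sum : \sum_(m < M) prior m = 1).

Lemma posteriorE n w : (forall i m a, 0 < lik m a (Zsym i w)) ->
  posterior q n w =
  fun m => prior m * likprod n w m / \sum_(m' < M) prior m' * likprod n w m'.
Proof.
move=> gw; elim: n => [|n IH].
  apply/funext => m /=; rewrite /likprod big_ord0 mulr1.
  rewrite (eq_bigr prior) => [|i _]; first by rewrite prior_sum divr1.
  by rewrite big_ord0 mulr1.
apply/funext => m; rewrite posteriorS IH /bayes_update.
have L0 k m' : 0 < likprod k w m' by apply: prodr_gt0.
have S0 k : 0 < \sum_(m' < M) prior m' * likprod k w m'.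
  by rewrite (bigD1 m)//= ltr_wpDr ?mulr_gt0//; apply: sumr_ge0 => i _; rewrite ltW ?mulr_gt0.
have LS m' : likprod n.+1 w m' = likprod n w m' * lik m' (mode n w) (Zsym n w).
  by rewrite /likprod big_ord_recr.
have -> : \sum_(m' < M) prior m' * likprod n w m' /
      (\sum_(k < M) prior k * likprod n w k) * lik m' (mode n w) (Zsym n w) =
    (\sum_(m' < M) prior m' * likprod n.+1 w m') / (\sum_(k < M) prior k * likprod n w k).
  by rewrite mulr_suml; apply: eq_bigr => m' _; rewrite LS; ring.
rewrite LS; field; rewrite !gt_eqF//=.
Qed.

End Mode.

Definition mode0 (n : nat) (w : Omega) : option 'I_M := None.

(** Index n is the message sent at time n + 1, so the second stage begins at n = n0. The option
    returned by [D0] doubles as the name of a family. *)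
Definition mode2 (u : R) (n : nat) (w : Omega) : option 'I_M :=
  if N0 P X prior phi0 u w is Some n0 then
    if (n0 <= n)%N then D0 P X prior phi0 u w else None
  else None.

Lemma quant0_mode n (w : Omega) : phi0 = qfam (mode0 n w) (Jfam (mode0 n w) n w).
Proof. by []. Qed.

Lemma quant2_mode u n w :
  quant2 P X prior phi0 phi J u n w = qfam (mode2 u n w) (Jfam (mode2 u n w) n w).
Proof.
rewrite /quant2 /mode2; case: N0 => [n0|//]; case: D0 => [k|]; last by case: ifP.
by rewrite ltnNge; case: (n0 <= n)%N.
Qed.

Local Notation post0 := (post0 P X prior phi0).
Local Notation post2 := (post2 P X prior phi0 phi J).
Local Notation N0 := (N0 P X prior phi0).
Local Notation D0 := (D0 P X prior phi0).
Local Notation Ntot := (Ntot P X prior phi0 phi J).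
Local Notation Dfin := (Dfin P X prior phi0 phi J).

Lemma post0_adapted n w w' : hist n w = hist n w' -> post0 n w = post0 n w'.
Proof. by move=> h; apply: (posterior_adapted quant0_mode). Qed.

Lemma N0_adapted u n n0 w w' : hist n w = hist n w' -> N0 u w = Some n0 ->
  (n0 <= n)%N -> N0 u w' = Some n0.
Proof.
move=> hw /first_hitP[h1 h2] n0n; apply/first_hitP; split.
  by rewrite -(post0_adapted (hist_le n0n hw)).
move=> k kn0; rewrite -(post0_adapted (hist_le _ hw)); first exact: h2.
exact: leq_trans (ltnW kn0) n0n.
Qed.

(** The first n symbols need not determine [N0], but they determine whether it is at most n, and
    then its value and the decision. If neither path has stopped by n, both are in the first
    stage. *)
Lemma mode2_adapted u n w w' : hist n w = hist n w' -> mode2 u n w = mode2 u n w'.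
Proof.
have main v v' n0 : hist n v = hist n v' -> N0 u v = Some n0 -> (n0 <= n)%N ->
    mode2 u n v = mode2 u n v'.
  move=> hv vn0 n0n; have v'n0 := N0_adapted hv vn0 n0n.
  rewrite /mode2 vn0 v'n0 n0n /D0 vn0 v'n0.
  by rewrite (post0_adapted (hist_le n0n hv)).
move=> hw.
have [[n0 []]|no] := pselect (exists n0, N0 u w = Some n0 /\ (n0 <= n)%N).
  exact: main.
have [[n0 [h1 h2]]|no'] := pselect (exists n0, N0 u w' = Some n0 /\ (n0 <= n)%N).
  by apply/esym/(main _ _ _ (esym hw) h1).
have none v : ~ (exists n0, N0 u v = Some n0 /\ (n0 <= n)%N) -> mode2 u n v = None.
  rewrite /mode2; case E : (N0 u v) => [n0|//]; case: ifP => // n0n nv.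
  by exfalso; apply: nv; exists n0.
by rewrite !none.
Qed.

Lemma post2_adapted u n w w' : hist n w = hist n w' -> post2 u n w = post2 u n w'.
Proof.
move=> h; apply: (posterior_adapted (quant2_mode u)) => // i ni.
by apply: mode2_adapted; exact: hist_le (ltnW ni) h.
Qed.

Lemma Ntot_some c u w n : Ntot c u w = Some n <->
  exists2 n0, N0 u w = Some n0 &
    first_hit (fun n => (n0 <= n)%N && (1 - c <= maxpost (post2 u n w))) = Some n.
Proof.
rewrite /Ntot; case: (N0 u w) => [n0|]; split=> //.
- by move=> h; exists n0.
- by case=> _ [<-].
- by case.
Qed.

Lemma Ntot_adapted c u n w w' : hist n w = hist n w' -> Ntot c u w = Some n ->
  Ntot c u w' = Some n.
Proof.
move=> hw /Ntot_some[n0 wn0 /first_hitP[/andP[n0n h1] h2]].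
apply/Ntot_some; exists n0; first exact: N0_adapted hw wn0 n0n.
apply/first_hitP; rewrite n0n -(post2_adapted u hw); split => // k kn.
by rewrite -(post2_adapted u (hist_le (ltnW kn) hw)); exact: h2.
Qed.

Lemma Dfin_measurable c u k : (forall n e, measurable [set w | Zsym n w = e]) ->
  measurable [set w | Dfin c u w = Some k].
Proof.
move=> mZ.
have -> : [set w | Dfin c u w = Some k] =
    [set w | exists n, Ntot c u w = Some n /\ argmaxpost (post2 u n w) = Some k].
  apply/seteqP; split => w; rewrite /Dfin /=.
    by case: (Ntot c u w) => [n h|//]; exists n.
  by case=> n [-> h].
apply: (adapted_exists_measurable mZ) => n w w' hw [h1 h2]; split.
  exact: Ntot_adapted hw h1.
by rewrite -(post2_adapted u hw).
Qed.

End Model.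

(** * The stopping rules in terms of log-likelihood ratios *)

Section ModelPath.
Context {R : realType} {d : measure_display} {Omega : measurableType d}
        {T : Type} {M : nat}.
Variables (P : 'I_M -> probability Omega R) (X : nat -> Omega -> T)
          (prior : 'I_M -> R) (phi0 : T -> bool) (phi : 'I_M -> nat -> T -> bool)
          (J : 'I_M -> nat -> Omega -> nat).

Local Notation lik := (lik P X phi0 phi).
Local Notation Zsym := (Zsym X phi0 phi J).
Local Notation post0 := (post0 P X prior phi0).
Local Notation post2 := (post2 P X prior phi0 phi J).
Local Notation N0 := (N0 P X prior phi0).
Local Notation D0 := (D0 P X prior phi0).
Local Notation Ntot := (Ntot P X prior phi0 phi J).
Local Notation Dfin := (Dfin P X prior phi0 phi J).
Local Notation likprod := (likprod P X phi0 phi J).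
Local Notation mode2 := (mode2 P X prior phi0).

Definition llr (m m' : 'I_M) (a : option 'I_M) (e : symbol) : R :=
  ln (lik m a e / lik m' a e).

Definition llr_sum (w : Omega) (m : 'I_M) (a : option 'I_M) (m' : 'I_M) (n : nat) : R :=
  \sum_(i < n) llr m m' a (Zsym i w).

Variables (C0 u c : R) (w : Omega).
Hypotheses (M_gt0 : (0 < M)%N)
  (prior_gt0 : forall m, 0 < prior m) (prior_sum : \sum_(m < M) prior m = 1)
  (prior_ge : forall m, expR (- C0) <= prior m)
  (u_gt0 : 0 < u) (u_le : u <= 1 / 2) (c_gt0 : 0 < c) (c_le : c <= 1 / 2)
  (lik_gt0 : forall i m a, 0 < lik m a (Zsym i w)).

Let likprod_gt0 mode n m : 0 < likprod mode n w m.
Proof. exact: prodr_gt0. Qed.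

Let ln_likprod_swap mode n m m' :
  ln (likprod mode n w m / likprod mode n w m') =
  - ln (likprod mode n w m' / likprod mode n w m).
Proof. by rewrite -lnV ?posrE ?divr_gt0// invf_div. Qed.

Lemma ln_likprod_ratio mode n m m' :
  ln (likprod mode n w m / likprod mode n w m') =
  \sum_(i < n) llr m m' (mode i w) (Zsym i w).
Proof.
elim: n => [|n IH]; first by rewrite /likprod !big_ord0 divr1 ln1.
have LS m0 : likprod mode n.+1 w m0 = likprod mode n w m0 * lik m0 (mode n w) (Zsym n w).
  by rewrite /likprod big_ord_recr.
rewrite big_ord_recr /= -IH !LS -lnM ?posrE ?divr_gt0// invfM.
by congr ln; ring.
Qed.

Lemma llr_sum_mode2 n0 k n m m' : N0 u w = Some n0 -> D0 u w = Some k -> (n0 <= n)%N ->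
  \sum_(i < n) llr m m' (mode2 u i w) (Zsym i w) =
  llr_sum w m None m' n0 + (llr_sum w m (Some k) m' n - llr_sum w m (Some k) m' n0).
Proof.
move=> N0E D0E /subnKC <-; elim: (n - n0)%N => [|j IH].
  rewrite addn0 subrr addr0; apply: eq_bigr => i _.
  by rewrite /mode2 N0E leqNgt ltn_ord.
rewrite addnS big_ord_recr /= IH /llr_sum big_ord_recr /=.
by rewrite /mode2 N0E D0E leq_addr; ring.
Qed.

Let post0E n : post0 n w = _ := posteriorE (quant0_mode phi0 phi J) prior_gt0 prior_sum n lik_gt0.

Let post2E n : post2 u n w = _ :=
  posteriorE (quant2_mode P X prior phi0 phi J u) prior_gt0 prior_sum n lik_gt0.

(** Together with [path_D0_spec], [path_N_le] and [path_N_spec] this supplies the hypotheses on the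
    stopping rules in the pathwise bounds, with C1 = C0 + 1. *)
Lemma path_N0_le m n :
  (forall m' : 'I_M, m' != m -> - ln u + C0 <= llr_sum w m None m' n) ->
  exists2 n0, N0 u w = Some n0 & (n0 <= n)%N.
Proof.
move=> h; apply: first_hit_le; apply: le_trans (le_maxpost _ m).
rewrite post0E; apply: (post_ge_of_llr (C0 := C0)) => // m' m'm.
by rewrite ln_likprod_ratio; exact: h.
Qed.

Lemma path_D0_spec m n0 : N0 u w = Some n0 ->
  exists2 k : 'I_M, D0 u w = Some k &
    (k != m -> llr_sum w m None k n0 <= - (- ln u) + (C0 + 1)).
Proof.
move=> N0E; have [k kE] := argmaxpost_some (post0 n0 w) M_gt0.
exists k; first by rewrite /D0 N0E.
move=> km; have /first_hitP[h1 _] := N0E.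
have u1 : 0 < 1 - u by have := u_le; lra.
have := argmaxpost_ge kE u1 h1; rewrite post0E.
move=> /(llr_ge_of_post prior_gt0 prior_sum prior_ge (likprod_gt0 _ _)) h.
have mk : m != k by rewrite eq_sym.
have {h} := h m mk u_gt0 u_le; rewrite ln_likprod_swap ln_likprod_ratio.
by rewrite -/(llr_sum w m None k n0); lra.
Qed.

Lemma path_N_le m n0 k n : N0 u w = Some n0 -> D0 u w = Some k -> (n0 <= n)%N ->
  (forall m' : 'I_M, m' != m -> - ln c + C0 <=
     llr_sum w m None m' n0 + (llr_sum w m (Some k) m' n - llr_sum w m (Some k) m' n0)) ->
  exists2 n', Ntot c u w = Some n' & (n' <= n)%N.
Proof.
move=> N0E D0E n0n h.
have [|n' h1 h2] := @first_hit_le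
    (fun n => (n0 <= n)%N && (1 - c <= maxpost (post2 u n w))) n.
  rewrite n0n /=; apply: le_trans (le_maxpost _ m).
  rewrite post2E; apply: (post_ge_of_llr (C0 := C0)) => // m' m'm.
  by rewrite ln_likprod_ratio (llr_sum_mode2 _ _ N0E D0E n0n); exact: h.
by exists n' => //; apply/Ntot_some; exists n0.
Qed.

Lemma Dfin_some n : Ntot c u w = Some n -> exists k, Dfin c u w = Some k.
Proof.
move=> NE; have [k kE] := argmaxpost_some (post2 u n w) M_gt0.
by exists k; rewrite /Dfin NE.
Qed.

Lemma Dfin_llr_ge k k' : Dfin c u w = Some k -> k' != k ->
  exists2 n, Ntot c u w = Some n &
    - ln c - (C0 + 1) <= ln (likprod (mode2 u) n w k / likprod (mode2 u) n w k').
Proof.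
move=> DE k'k; have : exists n, Ntot c u w = Some n.
  by move: DE; rewrite /Dfin; case: (Ntot c u w) => [n|//]; exists n.
move=> [n NE]; exists n => //.
have [n0 N0E /first_hitP[/andP[n0n h1] _]] := (Ntot_some _ _ _ _ _ _ _ _ _ _).1 NE.
have kE : argmaxpost (post2 u n w) = Some k by move: DE; rewrite /Dfin NE.
have c1 : 0 < 1 - c by have := c_le; lra.
have := argmaxpost_ge kE c1 h1; rewrite post2E => h.
exact: (llr_ge_of_post prior_gt0 prior_sum prior_ge (likprod_gt0 _ _) k'k c_gt0 c_le h).
Qed.

Lemma path_N_spec m n0 k n : N0 u w = Some n0 -> D0 u w = Some k -> Ntot c u w = Some n ->
  let LL m' := llr_sum w m None m' n0 +
     (llr_sum w m (Some k) m' n - llr_sum w m (Some k) m' n0) in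
  (n0 <= n)%N /\ ((forall m' : 'I_M, m' != m -> - ln c - (C0 + 1) <= LL m') \/
     exists2 k' : 'I_M, k' != m & LL k' <= - (- ln c) + (C0 + 1)).
Proof.
move=> N0E D0E NE LL.
have [k1 DE] := Dfin_some NE.
have n0n : (n0 <= n)%N.
  have [n0' N0E' /first_hitP[/andP[h _] _]] := (Ntot_some _ _ _ _ _ _ _ _ _ _).1 NE.
  by move: N0E'; rewrite N0E => -[->].
split => //; have [k1m|k1m] := eqVneq k1 m; [left|right].
  move=> m' m'm; rewrite -k1m in m'm; have [n' ] := Dfin_llr_ge DE m'm.
  by rewrite NE => -[<-]; rewrite ln_likprod_ratio (llr_sum_mode2 _ _ N0E D0E n0n) k1m.
exists k1 => //; rewrite eq_sym in k1m; have [n' ] := Dfin_llr_ge DE k1m.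
rewrite NE => -[<-]; rewrite ln_likprod_swap.
by rewrite ln_likprod_ratio (llr_sum_mode2 _ _ N0E D0E n0n) -/(LL k1); lra.
Qed.

End ModelPath.

(** * Null sets and countable laws *)

(** A set null under P' is [nu]-null where f' > 0, hence P-null there; elsewhere P puts no mass, by
    the almost sure positivity of f'. Thus a message impossible under one state is impossible under
    all, and log-likelihood ratios stay finite. *)
Lemma density_null_transfer {R : realType} {dT dO : measure_display}
    {T : measurableType dT} {Omega : measurableType dO}
    (nu : {measure set T -> \bar R}) (P P' : probability Omega R) (Y : Omega -> T)
    (f f' : T -> R) (A : set T) :
  measurable_fun setT Y -> measurable_fun setT f -> measurable_fun setT f' ->
  (forall x, 0 <= f' x) ->
  (forall B, measurable B -> P (Y @^-1` B) = \int[nu]_(x in B) (f x)%:E)%E ->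
  (forall B, measurable B -> P' (Y @^-1` B) = \int[nu]_(x in B) (f' x)%:E)%E ->
  {ae P, forall w, 0 < f' (Y w)} -> measurable A ->
  P' (Y @^-1` A) = 0%E -> P (Y @^-1` A) = 0%E.
Proof.
move=> mY mf mf' f'0 Pf Pf' ae mA P'A.
have mE (g : T -> R) B : measurable_fun setT g -> measurable_fun B (EFin \o g).
  by move=> mg; apply/measurable_EFinP; exact: measurable_funS mg.
have mpre B : measurable B -> measurable (Y @^-1` B).
  by move=> mB; rewrite -[_ @^-1` _]setTI; exact: mY.
pose Pos := [set x | 0 < f' x].
have mPos : measurable Pos.
  rewrite (_ : Pos = f' @^-1` `]0, +oo[%classic).
    by rewrite -[_ @^-1` _]setTI; exact: mf'.
  by apply/seteqP; split => x; rewrite /Pos/= in_itv/= andbT.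
have nuA : nu (A `&` Pos) = 0%E.
  have /ae_eq_integral_abs h : measurable_fun A (EFin \o f') by exact: mE.
  have {h}[h _] := h nu mA.
  have : (\int[nu]_(x in A) `|(EFin \o f') x|)%E = 0%E.
    rewrite -[RHS]P'A Pf'//; apply: eq_integral => x _ /=.
    by rewrite ger0_norm.
  move/h => ae0; apply: measure_negligible; first exact: measurableI.
  apply: negligibleS ae0 => x [Ax fx] /= h0; have [] := h0 Ax => fx0.
  by move: fx; rewrite /Pos /= fx0 ltxx.
have -> : Y @^-1` A = Y @^-1` (A `&` Pos) `|` Y @^-1` (A `\` Pos).
  apply/seteqP; split => [w Aw|w [[]|[]]//].
  by have [h|h] := pselect (Pos (Y w)); [left|right].
apply: measure_negligible.
  by apply: measurableU; apply: mpre; [exact: measurableI|exact: measurableD].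
apply: negligibleU.
  exists (Y @^-1` (A `&` Pos)); split => //; first by apply: mpre; exact: measurableI.
  apply: eq_trans (Pf _ _) _; first exact: measurableI.
  by apply: null_set_integral => //; [exact: measurableI|exact: mE].
by apply: negligibleS ae => w [_ h] /= h0; apply: h.
Qed.

Section CountableLaw.
Context {R : realType} {d : measure_display} {Omega : measurableType d}
        (P : probability Omega R) {E : countType} (Y : Omega -> E).
Hypothesis Ymeas : forall e, measurable [set w | Y w = e].

Lemma countable_law_null (B : E -> Prop) :
  (forall e, B e -> P [set w | Y w = e] = 0%E) -> P [set w | B (Y w)] = 0%E.
Proof.
move=> h.
pose F k := if unpickle k is Some e then [set w | Y w = e /\ B e] else set0.
have mB e : measurable [set w | Y w = e /\ B e].
  have [Be|nB] := pselect (B e).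
    by have := Ymeas e; congr measurable; apply/seteqP; split => [w we|w []].
  by rewrite (_ : mkset _ = set0)//; apply/seteqP; split => // w [].
have mF k : measurable (F k) by rewrite /F; case: unpickle.
have -> : [set w | B (Y w)] = \bigcup_k F k.
  apply/seteqP; split => [w Bw|w [k _]].
    by exists (pickle (Y w)) => //; rewrite /F pickleK.
  by rewrite /F; case: unpickle => // e [we Be] /=; rewrite we.
apply: measure_negligible; first exact: bigcupT_measurable.
apply: negligible_bigcup => k; rewrite /F; case: unpickle => [e|].
  have [Be|nB] := pselect (B e); last first.
    exists set0; split => //; by move=> w [].
  by exists [set w | Y w = e]; split => //; [exact: h|move=> w []].
exact: negligible_set0.
Qed.

Lemma finite_law_sum (s : seq E) (Q : pred E) : uniq s ->
  P [set w | Y w \in s /\ Q (Y w)] = (\sum_(e <- s | Q e) P [set w | Y w = e])%E.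
Proof.
elim: s => [_|e s IH] /=.
  by rewrite big_nil (_ : mkset _ = set0) ?measure0//; apply/seteqP; split => // w [].
move=> /andP[es us]; rewrite big_cons.
have mR : measurable [set w | Y w \in s /\ Q (Y w)].
  apply: (@adapted_measurable _ _ _ (fun _ => Y) (fun _ => Ymeas) 1) => w w'.
  by move=> /hist_eqP/(_ 0%N isT) /= we; rewrite /= we.
have split_e : [set w | Y w \in e :: s /\ Q (Y w)] =
    (if Q e then [set w | Y w = e] else set0) `|` [set w | Y w \in s /\ Q (Y w)].
  apply/seteqP; split => w /=.
    move=> [+ Qw]; rewrite inE => /orP[/eqP we|ws]; last by right.
    by left; rewrite -we Qw.
  case=> [|[ws Qw]]; last by rewrite inE ws orbT.
  by case: ifP => // Qe /= ->; rewrite mem_head.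
rewrite split_e; case: ifP => Qe; last by rewrite set0U IH.
have dis : [set w | Y w = e] `&` [set w | Y w \in s /\ Q (Y w)] = set0.
  by apply/seteqP; split => // w [/= we [ws _]]; move: es; rewrite -we ws.
by apply: eq_trans (measureU P (Ymeas e) mR dis) _; congr (_ + _)%E; exact: IH.
Qed.

End CountableLaw.

(** * The law of the symbols *)

Section ModelLaw.
Context {R : realType} {dO dT : measure_display} {Omega : measurableType dO}
        {T : measurableType dT} {M : nat}.
Variables (P : 'I_M -> probability Omega R) (X : nat -> Omega -> T)
          (phi0 : T -> bool) (phi : 'I_M -> nat -> T -> bool)
          (J : 'I_M -> nat -> Omega -> nat)
          (K : 'I_M -> nat) (p : 'I_M -> nat -> R).

Hypotheses
  (X_meas : forall n, measurable_fun setT (X n))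
  (X_ident : forall m n A, measurable A -> P m (X n @^-1` A) = P m (X 0%N @^-1` A))
  (X_null : forall m m' A, measurable A ->
     P m' (X 0%N @^-1` A) = 0%E -> P m (X 0%N @^-1` A) = 0%E)
  (J_meas : forall m' n k, measurable (J m' n @^-1` [set k]))
  (J_law : forall m m' n k, P m (J m' n @^-1` [set k]) = (p m' k)%:E)
  (indep : forall m, mutually_independent (P m)
     (fun i : (nat + (nat * 'I_M))%type =>
        match i with
        | inl n => [set X n @^-1` A | A in measurable]
        | inr (n, m') => [set J m' n @^-1` B | B in [set: set nat]]
        end))
  (phi0_meas : measurable [set x | phi0 x])
  (phi_meas : forall m k, measurable [set x | phi m k x])
  (p_ge0 : forall m k, 0 <= p m k)
  (p_supp : forall m k, (K m <= k)%N -> p m k = 0)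
  (p_sum : forall m, \sum_(k < K m) p m k = 1).

Local Notation lik := (lik P X phi0 phi).
Local Notation Zsym := (Zsym X phi0 phi J).
Local Notation qfam := (qfam phi0 phi).
Local Notation Jfam := (Jfam J).
Local Notation symbol := (symbol (M := M)).

Definition pfam (a : option 'I_M) (j : nat) : R :=
  if a is Some k then p k j else (j == 0%N)%:R.

Definition Kfam (a : option 'I_M) : nat := if a is Some k then K k else 1%N.

Lemma qfam_meas a j b : measurable [set x | qfam a j x = b].
Proof.
have h : measurable [set x | qfam a j x] by case: a => [k|]; [exact: phi_meas|].
case: b => //; rewrite (_ : mkset _ = ~` [set x | qfam a j x]); first exact: measurableC.
by apply/seteqP; split => x /=; case: (qfam a j x).
Qed.

Let X_pre n A : measurable A -> measurable (X n @^-1` A).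
Proof. by move=> mA; rewrite -[_ @^-1` _]setTI; exact: X_meas. Qed.

(** Once the indices are fixed, the messages constrain the raw observation alone. A symbol event
    therefore splits into one event for X and one for each selector, to which independence
    applies. *)
Definition cell (e : symbol) : set T :=
  \big[setI/setT]_(a <- enum [the finType of option 'I_M])
     [set x | qfam a (e a).1 x = (e a).2].

Lemma cellP e x : cell e x <-> forall a, qfam a (e a).1 x = (e a).2.
Proof.
rewrite /cell -bigcap_seq; split=> [h a|h a _]; last exact: h.
by apply: h; rewrite /= mem_enum.
Qed.

Lemma cell_meas e : measurable (cell e).
Proof. by apply: bigsetI_measurable => a _; exact: qfam_meas. Qed.

(** The first-stage family draws no index, so its slot [None] is free to stand for the raw
    observation. *)
Definition event_index (n : nat) (o : option 'I_M) : nat + (nat * 'I_M) :=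
  if o is Some k then inr (n, k) else inl n.

Definition symbol_event (h : nat -> symbol) (i : nat + (nat * 'I_M)) : set Omega :=
  match i with
  | inl n => X n @^-1` cell (h n)
  | inr (n, k) => J k n @^-1` [set (h n (Some k)).1]
  end.

Definition symbol_prob (m : 'I_M) (e : symbol) : R :=
  \prod_(o <- enum [the finType of option 'I_M])
    (if o is Some k then p k (e o).1 else fine (P m (X 0%N @^-1` cell e))).

Lemma symbol_event_meas h i : measurable (symbol_event h i).
Proof. by case: i => [n|[n k]]; [apply: X_pre; exact: cell_meas|exact: J_meas]. Qed.

Lemma Zsym_eqP n w (e : symbol) : Zsym n w = e <->
  (e None).1 = 0%N /\ forall o, symbol_event (fun=> e) (event_index n o) w.
Proof.
split=> [<-|[e0 h]].
  split=> [|[k|]]; rewrite /= ?ffunE//=.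
  by apply/cellP => a; rewrite !ffunE.
have Je a : Jfam a n w = (e a).1.
  by case: a => [k|]; [exact: (h (Some k))|rewrite e0].
apply/ffunP => a; rewrite ffunE Je; have /cellP -> := h None.
by rewrite -surjective_pairing.
Qed.

Lemma Zsym_meas n e : measurable [set w | Zsym n w = e].
Proof.
have [e0|e0] := eqVneq (e None).1 0%N; last first.
  rewrite (_ : mkset _ = set0)//; apply/seteqP; split => // w /Zsym_eqP[/eqP].
  by rewrite (negPf e0).
rewrite (_ : mkset _ = \big[setI/setT]_(o <- enum [the finType of option 'I_M])
    symbol_event (fun=> e) (event_index n o)).
  by apply: bigsetI_measurable => o _; exact: symbol_event_meas.
rewrite -bigcap_seq; apply/seteqP; split => w.
  by move=> /Zsym_eqP[_ h] o _; exact: h.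
by move=> h; apply/Zsym_eqP; split => // o; apply: h; rewrite /= mem_enum.
Qed.

(** The restriction on [None] is needed because [symbol_prob] does not see that index, while symbols
    with a nonzero one never occur. *)
Lemma hist_law_prod (m : 'I_M) (h : seq symbol) :
  {in h, forall e : symbol, (e None).1 = 0%N} ->
  P m [set w | hist Zsym (size h) w = h] = (\prod_(e <- h) symbol_prob m e)%:E.
Proof.
move=> h0; pose e0 : symbol := [ffun=> (0%N, true)].
pose opts := enum [the finType of option 'I_M].
(* All sources up to the length of the word, each listed once, so that mutual independence is used a
   single time. *)
pose idx := [seq event_index n o | n <- iota 0 (size h), o <- opts].
have uidx : uniq idx.
  apply: allpairs_uniq; rewrite ?iota_uniq ?enum_uniq//.
  by move=> [n [k|]] [n' [k'|]] _ _ //= [] -> // ->.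
have := indep m uidx (A := symbol_event (nth e0 h)).
have -> : [set w | hist Zsym (size h) w = h] =
    \big[setI/setT]_(i <- idx) symbol_event (nth e0 h) i.
  rewrite -bigcap_seq; apply/seteqP; split => w.
    move=> /= hw i /allpairsP[[n o] /= [+ _ ->]].
    rewrite mem_iota add0n => /= nh.
    have : Zsym n w = nth e0 h n by rewrite -[in RHS]hw nth_mkseq.
    by move=> /Zsym_eqP[_ /(_ o)]; case: o.
  move=> H /=; apply: (@eq_from_nth _ e0) => [|n]; rewrite size_mkseq// => nh.
  rewrite nth_mkseq//; apply/Zsym_eqP; split; first by apply: h0; exact: mem_nth.
  move=> o; have : symbol_event (nth e0 h) (event_index n o) w.
    apply: H => /=; apply/allpairsP; exists (n, o) => /=.
    by rewrite mem_iota add0n nh mem_enum.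
  by case: o.
move=> ->; last first.
  move=> i /allpairsP[[n o] /= [_ _ ->]]; case: o => [k|] /=.
    by exists [set (nth e0 h n (Some k)).1].
  by exists (cell (nth e0 h n)) => //; exact: cell_meas.
rewrite big_allpairs_dep /= (big_nth e0) /index_iota subn0 -prodEFin.
apply: eq_bigr => n _; rewrite /symbol_prob -prodEFin; apply: eq_bigr => -[k|] _ /=.
  by rewrite J_law.
by rewrite X_ident ?fineK ?fin_num_measure//; try apply: X_pre; exact: cell_meas.
Qed.

Lemma Zsym_law m (e : symbol) : (e None).1 = 0%N ->
  P m [set w | Zsym 0 w = e] = (symbol_prob m e)%:E.
Proof.
move=> e0; have := @hist_law_prod m [:: e]; rewrite big_seq1 => <-; last first.
  by move=> e'; rewrite inE => /eqP ->.
by congr (P m _); apply/seteqP; split => w; rewrite /hist /mkseq /=; [move=> ->|case].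
Qed.

(** Positivity is asked under every state, not only the true one, so that no log-likelihood ratio on
    these symbols is a default value of [ln] or of division. *)
Definition good_symbol (e : symbol) : bool :=
  [forall a, ((e a).1 < Kfam a)%N && [forall m, 0 < lik m a e]].

Definition symbol_of_bounded (n : nat) (g : {ffun option 'I_M -> 'I_n * bool}) : symbol :=
  [ffun a => (nat_of_ord (g a).1, (g a).2)].

Definition good_symbols : seq symbol :=
  [seq e <- map (@symbol_of_bounded (\max_k K k)%N.+1)
     (enum [the finType of {ffun option 'I_M -> 'I_(\max_k K k)%N.+1 * bool}]) | good_symbol e].

Lemma good_symbols_uniq : uniq good_symbols.
Proof.
apply: filter_uniq; rewrite map_inj_uniq ?enum_uniq// => g g' /ffunP gg.
apply/ffunP => a; have := gg a; rewrite !ffunE.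
by case: (g a) (g' a) => [i b] [i' b'] /= [/ord_inj -> ->].
Qed.

Lemma mem_good_symbols e : (e \in good_symbols) = good_symbol e.
Proof.
rewrite mem_filter; case ge : (good_symbol e) => //=.
have lt a : ((e a).1 < (\max_k K k).+1)%N.
  have /forallP/(_ a)/andP[h _] := ge; apply: leq_trans h _.
  by case: a => [k|//]; rewrite ltnW// ltnS /=; exact: (leq_bigmax k).
apply/mapP; exists [ffun a => (Ordinal (lt a), (e a).2)]; first by rewrite mem_enum.
by apply/ffunP => a; rewrite !ffunE /= -surjective_pairing.
Qed.

Lemma good_symbol_None0 (e : symbol) : e \in good_symbols -> (e None).1 = 0%N.
Proof.
rewrite mem_good_symbols => /forallP/(_ None)/andP[+ _] /=.
by rewrite ltnS leqn0 => /eqP.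
Qed.

Lemma good_symbol_lik m a e : e \in good_symbols -> 0 < lik m a e.
Proof. by rewrite mem_good_symbols => /forallP/(_ a)/andP[_ /forallP]. Qed.

Lemma lik_ge0 m a e : 0 <= lik m a e.
Proof. by rewrite /lik /qprob fine_ge0. Qed.

Lemma Zsym_good m n : P m [set w | Zsym n w \notin good_symbols] = 0%E.
Proof.
apply: (countable_law_null (Zsym_meas n) (B := fun e => is_true (e \notin good_symbols))).
move=> e; rewrite mem_good_symbols => /forallPn[a]; rewrite negb_and => /orP[].
  rewrite -leqNgt => Ka; case: a Ka => [k|] /= Ka.
    apply: (subset_measure0 (B := J k n @^-1` [set (e (Some k)).1])) => //.
    - exact: Zsym_meas.
    - by move=> w /Zsym_eqP[_ /(_ (Some k))].
    - by apply: eq_trans (J_law _ _ _ _) _; rewrite p_supp.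
  rewrite (_ : mkset _ = set0) ?measure0//; apply/seteqP; split => // w.
  by move=> /Zsym_eqP[e0 _]; move: Ka; rewrite e0.
(* The remaining case is a message of probability zero under some [m']; [X_null] carries this over
   to the true state [m]. *)
move=> /forallPn[m']; rewrite -leNgt => lik_le.
have lik0 : lik m' a e = 0 by apply/eqP; rewrite eq_le lik_le lik_ge0.
pose A := [set x | qfam a (e a).1 x = (e a).2].
have mA : measurable A by exact: qfam_meas.
apply: (subset_measure0 (B := X n @^-1` A)) => //.
- exact: Zsym_meas.
- exact: X_pre.
- by move=> w /Zsym_eqP[_ /(_ None)] /cellP h; exact: h.
apply: eq_trans (X_ident _ _ mA) _; apply: (@X_null m m') => //.
have := lik0; rewrite /lik /qprob -/A => fin0.
by rewrite -[LHS]fineK ?fin_num_measure//; [rewrite fin0|exact: X_pre].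
Qed.

(** Preferred to the product formula [symbol_prob] because its marginals are directly probabilities
    of events; the two agree when the index at [None] is 0. *)
Definition symbol_mass (m : 'I_M) (e : symbol) : R := fine (P m [set w | Zsym 0 w = e]).

Lemma symbol_mass_ge0 m e : 0 <= symbol_mass m e.
Proof. exact: fine_ge0. Qed.

Lemma symbol_massE m e : (symbol_mass m e)%:E = P m [set w | Zsym 0 w = e].
Proof. by rewrite /symbol_mass fineK// fin_num_measure//; exact: Zsym_meas. Qed.

Lemma hist_law m (h : seq symbol) : {subset h <= good_symbols} ->
  P m [set w | hist Zsym (size h) w = h] = (\prod_(e <- h) symbol_mass m e)%:E.
Proof.
move=> hg; rewrite hist_law_prod => [|e /hg]; last exact: good_symbol_None0.
congr EFin; rewrite big_seq [RHS]big_seq; apply: eq_bigr => e /hg/good_symbol_None0 e0.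
by rewrite /symbol_mass Zsym_law.
Qed.

Lemma Jfam_qfam_indep m a j b : (j < Kfam a)%N ->
  P m [set w | Jfam a 0 w = j /\ qfam a j (X 0%N w) = b] =
  (pfam a j * qprob P X m (qfam a j) b)%:E.
Proof.
have mA := qfam_meas a j b.
have qE : (qprob P X m (qfam a j) b)%:E = P m [set w | qfam a j (X 0%N w) = b].
  by rewrite /qprob fineK// fin_num_measure//; exact: (X_pre 0 mA).
case: a mA qE => [k|] mA qE /=; last first.
  rewrite ltnS leqn0 => /eqP ->; rewrite mul1r qE.
  by congr (P m _); apply/seteqP; split => w [].
move=> _; have := indep m (s := [:: inl 0%N; inr (0%N, k)])
  (A := fun i => match i with inl _ => X 0%N @^-1` [set x | qfam (Some k) j x = b]
                 | inr _ => J k 0%N @^-1` [set j] end).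
rewrite !big_cons !big_nil setIT mule1 J_law EFinM qE muleC => <-//.
  by congr (P m _); apply/seteqP; split => w [].
move=> i; rewrite !inE => /orP[/eqP->|/eqP->].
  by exists [set x | qfam (Some k) j x = b].
by exists [set j].
Qed.

Lemma symbol_mass_marginal m a j b : (j < Kfam a)%N ->
  \sum_(e <- good_symbols | e a == (j, b)) symbol_mass m e =
  pfam a j * qprob P X m (qfam a j) b.
Proof.
move=> jK; apply: EFin_inj; rewrite -sumEFin -Jfam_qfam_indep//.
rewrite (eq_bigr _ (fun e _ => symbol_massE m e)).
rewrite -(finite_law_sum (P m) (Zsym_meas 0) _ good_symbols_uniq).
set A := [set w | Jfam a 0 w = j /\ _].
have AE : A = [set w | Zsym 0 w a = (j, b)].
  apply/seteqP; split => w /=; rewrite ffunE; first by move=> [-> ->].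
  by case=> aj jb; rewrite /A/= -jb aj.
have mA : measurable A.
  rewrite AE; apply: (adapted_measurable Zsym_meas (n := 1%N)) => w w'.
  by move=> /hist_eqP/(_ 0%N isT) /= we; rewrite /= we.
have mN : measurable [set w | Zsym 0 w \notin good_symbols].
  apply: (adapted_measurable Zsym_meas (n := 1%N)) => w w'.
  by move=> /hist_eqP/(_ 0%N isT) /= we; rewrite /= we.
have mG : measurable [set w | Zsym 0 w \in good_symbols /\ Zsym 0 w a == (j, b)].
  apply: (adapted_measurable Zsym_meas (n := 1%N)) => w w'.
  by move=> /hist_eqP/(_ 0%N isT) /= we; rewrite /= we.
apply/eqP; rewrite eq_le; apply/andP; split.
  by apply: le_measure; rewrite ?inE// AE => w [_ /eqP].
apply: (@le_trans _ _ (P m ([set w | Zsym 0 w \notin good_symbols] `|`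
    [set w | Zsym 0 w \in good_symbols /\ Zsym 0 w a == (j, b)]))).
  apply: le_measure; rewrite ?inE//; first exact: measurableU.
  rewrite AE => w /= we; have [h|h] := boolP (Zsym 0 w \in good_symbols); last by left.
  by right; split => //; rewrite we.
apply: le_trans (measureU2 _ mN mG) _.
by rewrite [X in (X + _)%E](Zsym_good m 0) add0e.
Qed.

(** Its instances give the total mass, the drift as a divergence, and the condition for Ville's
    inequality. *)
Lemma symbol_mass_sum m a (G : nat * bool -> R) :
  \sum_(e <- good_symbols) symbol_mass m e * G (e a) =
  \sum_(j < Kfam a) pfam a j * \sum_(b : bool) qprob P X m (qfam a j) b * G (nat_of_ord j, b).
Proof.
pose key (e : symbol) (jb : 'I_(Kfam a) * bool) := e a == (nat_of_ord jb.1, jb.2).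
transitivity (\sum_(e <- good_symbols)
    \sum_(jb : 'I_(Kfam a) * bool | key e jb) symbol_mass m e * G (nat_of_ord jb.1, jb.2)).
  rewrite big_seq [RHS]big_seq; apply: eq_bigr => e.
  rewrite mem_good_symbols => /forallP/(_ a)/andP[lt _].
  rewrite (big_pred1 (Ordinal lt, (e a).2)) /=; first by rewrite -surjective_pairing.
  move=> [i b] /=; rewrite /key /=; case: (e a) lt => i' b' /= lt.
  by rewrite !xpair_eqE -val_eqE /= eq_sym (eq_sym b).
rewrite (exchange_big_dep xpredT)//=.
rewrite -(pair_big xpredT xpredT (fun j b =>
  \sum_(e <- good_symbols | key e (j, b)) symbol_mass m e * G (nat_of_ord j, b)))/=.
apply: eq_bigr => j _; rewrite mulr_sumr; apply: eq_bigr => b _.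
by rewrite -mulr_suml symbol_mass_marginal// mulrA.
Qed.

Lemma qfam_prob_sum m a j : \sum_(b : bool) qprob P X m (qfam a j) b = 1.
Proof.
have mE b : measurable [set w | qfam a j (X 0%N w) = b].
  exact: (X_pre 0 (qfam_meas a j b)).
rewrite big_bool /=; apply: EFin_inj; rewrite EFinD /qprob.
rewrite !fineK ?fin_num_measure//; try exact: mE.
rewrite -measureU//; try exact: mE.
  rewrite (_ : _ `|` _ = setT); first exact: probability_setT.
  by apply/seteqP; split => // w _; case E : (qfam a j (X 0%N w)); [left|right].
by apply/seteqP; split => // w [/= ->].
Qed.

Lemma pfam_sum a : \sum_(j < Kfam a) pfam a j = 1.
Proof. by case: a => [k|] /=; [exact: p_sum|rewrite big_ord1]. Qed.

Lemma pfam_ge0 a j : 0 <= pfam a j.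
Proof. by case: a => [k|] /=. Qed.

Lemma symbol_mass_total m : \sum_(e <- good_symbols) symbol_mass m e = 1.
Proof.
have := symbol_mass_sum m None (fun=> 1).
under eq_bigr do rewrite mulr1; move=> ->.
under eq_bigr do under eq_bigr do rewrite mulr1.
by under eq_bigr do rewrite qfam_prob_sum mulr1; exact: pfam_sum.
Qed.

Lemma symbol_mass_llr m m' a :
  \sum_(e <- good_symbols) symbol_mass m e * llr P X phi0 phi m m' a e =
  KLr P X m m' (Kfam a) (pfam a) (qfam a).
Proof.
exact: (symbol_mass_sum m a (fun jb => ln (qprob P X m (qfam a jb.1) jb.2 /
                                           qprob P X m' (qfam a jb.1) jb.2))).
Qed.

(** For each quantizer the sum is the [m']-probability of the messages possible under [m].
    Impossible ones contribute 0 since division by zero gives 0, whence an inequality. *)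
Lemma symbol_mass_ratio m m' a :
  \sum_(e <- good_symbols) symbol_mass m e * (lik m' a e / lik m a e) <= 1.
Proof.
rewrite (symbol_mass_sum m a (fun jb => qprob P X m' (qfam a jb.1) jb.2 /
                                           qprob P X m (qfam a jb.1) jb.2)) /=.
rewrite -[leRHS](pfam_sum a); apply: ler_sum => j _; apply: ler_piMr.
  exact: pfam_ge0.
rewrite -[leRHS](qfam_prob_sum m' a j); apply: ler_sum => b _.
have [->|q0] := eqVneq (qprob P X m (qfam a j) b) 0; first by rewrite mul0r fine_ge0.
by rewrite mulrC divfK.
Qed.

End ModelLaw.

(** * Finite bounds and the regime of small c *)

Lemma seq_uniform_bound {R : realType} (I : finType) (E : eqType) (s : seq E)
    (F : I -> E -> R) : exists2 B, 0 <= B & forall i, {in s, forall e, `|F i e| <= B}.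
Proof.
exists (\sum_(e <- s) \sum_(i : I) `|F i e|) => [|i e es].
  by apply: sumr_ge0 => e _; apply: sumr_ge0.
apply: (@le_trans _ _ (\sum_(i : I) `|F i e|)).
  by rewrite (bigD1 i)//= lerDl sumr_ge0.
rewrite (perm_big _ (perm_to_rem es)) big_cons lerDl.
by apply: sumr_ge0 => e' _; apply: sumr_ge0.
Qed.

Lemma asymptotic_scales {R : realType} (u : R -> R) :
  (forall c, 0 < c -> 0 < u c < 1 / 2) ->
  u @ 0^'+ --> (0 : R) -> (fun c => ln (u c) / ln c) @ 0^'+ --> (0 : R) ->
  forall A eta : R, 0 < eta -> \forall c \near 0^'+,
    [/\ 0 < c <= 1 / 2, 0 < u c <= 1 / 2, A < - ln c, A < - ln (u c) &
        - ln (u c) <= eta * - ln c].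
Proof.
move=> u01 u0 ratio0 A eta eta0.
have small (x : R) : 0 < x -> x < expR (- A) -> A < - ln x.
  by move=> x0 xA; rewrite ltrNr -ltr_expR lnK.
near=> c.
have c0 : 0 < c by near: c; exact: nbhs_right_gt.
have c12 : c < 1 / 2 by near: c; apply: nbhs_right_lt.
have cA : c < expR (- A) by near: c; apply: nbhs_right_lt; exact: expR_gt0.
have /andP[u1 u2] := u01 c c0.
have uA : u c < expR (- A).
  by near: c; apply: (cvgr_lt 0 u0); exact: expR_gt0.
have r1 : `|ln (u c) / ln c| < eta.
  by near: c; apply: (cvgr0_norm_lt _ ratio0).
split.
- by rewrite c0 ltW.
- by rewrite u1 ltW.
- exact: small.
- exact: small.
have lc : ln c < 0 by apply: ln_lt0; rewrite c0/=; lra.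
have lu : ln (u c) < 0 by apply: ln_lt0; rewrite u1/=; lra.
move: r1; rewrite normf_div (ltr0_norm lc) (ltr0_norm lu) ltr_pdivrMr ?oppr_gt0//.
exact: ltW.
Unshelve. all: by end_near. Qed.

(** * Asymptotics under one state *)

Section StateAsymptotics.
Context {R : realType} {d : measure_display} {Omega : measurableType d}
        {T : Type} {M : nat}.
Variables (P : 'I_M -> probability Omega R) (X : nat -> Omega -> T)
          (prior : 'I_M -> R) (phi0 : T -> bool) (phi : 'I_M -> nat -> T -> bool)
          (J : 'I_M -> nat -> Omega -> nat).

Local Notation symbol := (symbol (M := M)).
Local Notation lik := (lik P X phi0 phi).
Local Notation Zsym := (Zsym X phi0 phi J).
Local Notation N0 := (N0 P X prior phi0).
Local Notation D0 := (D0 P X prior phi0).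
Local Notation Ntot := (Ntot P X prior phi0 phi J).
Local Notation Ntot_ext := (Ntot_ext P X prior phi0 phi J).
Local Notation Dfin := (Dfin P X prior phi0 phi J).
Local Notation EN := (EN P X prior phi0 phi J).
Local Notation llr := (llr P X phi0 phi).
Local Notation llr_sum := (llr_sum P X phi0 phi J).

Variables (s : seq symbol) (mass : symbol -> R) (m : 'I_M)
  (mean : option 'I_M -> 'I_M -> R) (Im : R) (ms : 'I_M) (u : R -> R).

Hypotheses (M_gt0 : (0 < M)%N)
  (prior_gt0 : forall k, 0 < prior k) (prior_sum : \sum_(k < M) prior k = 1)
  (Zmeas : forall n e, measurable [set w | Zsym n w = e])
  (mass_ge0 : forall e, 0 <= mass e)
  (Zs : forall n, P m [set w | Zsym n w \notin s] = 0%E)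
  (Zlaw : forall h : seq symbol, {subset h <= s} ->
     P m [set w | hist Zsym (size h) w = h] = (\prod_(e <- h) mass e)%:E)
  (mass_sum : \sum_(e <- s) mass e = 1)
  (mass_llr : forall a m', \sum_(e <- s) mass e * llr m m' a e = mean a m')
  (mass_ratio : forall k a, \sum_(e <- s) mass e * (lik k a e / lik m a e) <= 1)
  (lik_gt0 : forall k a e, e \in s -> 0 < lik k a e)
  (lik_ge0 : forall k a e, 0 <= lik k a e)
  (mean_gt0 : forall a (m' : 'I_M), m' != m -> 0 < mean a m')
  (msm : ms != m) (mean_ms : mean (Some m) ms = Im)
  (Im_le : forall m' : 'I_M, m' != m -> Im <= mean (Some m) m')
  (scales : forall A eta : R, 0 < eta -> \forall c \near 0^'+,
    [/\ 0 < c <= 1 / 2, 0 < u c <= 1 / 2, A < - ln c, A < - ln (u c) &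
        - ln (u c) <= eta * - ln c]).

Let Im_gt0 : 0 < Im. Proof. by rewrite -mean_ms; exact: mean_gt0. Qed.

Let prior_bound : exists2 C0 : R, 0 <= C0 & forall k, expR (- C0) <= prior k.
Proof.
have l0 k : 0 <= - ln (prior k).
  by rewrite oppr_ge0; apply: ln_le0; exact: (prior_le1 prior_gt0 prior_sum).
exists (\sum_(k < M) - ln (prior k)); first exact: sumr_ge0.
move=> k; rewrite -[leRHS]lnK ?posrE// ler_expR lerNl (bigD1 k)//= lerDl.
exact: sumr_ge0.
Qed.

Let Is_exists : exists Is : R, [/\ 0 < Is, Is <= Im &
  forall a (m' : 'I_M), m' != m -> Is <= mean a m'].
Proof.
pose Is := \big[Num.min/1]_(i : option 'I_M * 'I_M | i.2 != m) mean i.1 i.2.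
have Is_le a (m' : 'I_M) : m' != m -> Is <= mean a m'.
  by move=> m'm; exact: (@bigmin_le_cond _ _ _ _ (a, m')).
exists Is; split => //; last by rewrite -mean_ms; exact: Is_le.
by apply: lt_bigmin => // -[a m'] /= m'm; exact: mean_gt0.
Qed.

Let llr_bound : exists2 B : R, 0 <= B & forall a m', {in s, forall e, `|llr m m' a e| <= B}.
Proof.
have [B B0 h] := seq_uniform_bound s (fun (i : option 'I_M * 'I_M) e => llr m i.2 i.1 e).
by exists B => // a m'; exact: (h (a, m')).
Qed.

Definition bad (dl : R) : nat -> set Omega :=
  deviates Zsym s (fun (i : option 'I_M * 'I_M) e => llr m i.2 i.1 e)
           (fun i => mean i.1 i.2) dl.

Let bad_tail dl : 0 < dl -> exists C rho : R, [/\ 0 <= C, 0 < rho, rho < 1 &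
  forall n, (P m (bad dl n) <= (C * rho ^+ n)%:E)%E].
Proof.
move=> dl0; have [B _ h] := llr_bound.
by apply: (deviates_le Zmeas mass_ge0 Zs Zlaw (B := B)) => // -[a m'] //; exact: h.
Qed.

Let bad_meas dl n : measurable (bad dl n).
Proof. exact: deviates_measurable. Qed.

Let not_badP dl n w : ~ bad dl n w ->
  [/\ forall i, Zsym i w \in s,
      forall i k a, 0 < lik k a (Zsym i w) &
      forall a m' k, (n <= k)%N ->
        `|llr_sum w m a m' k - mean a m' * k%:R| <= dl * k%:R].
Proof.
move=> nb; have Zin i : Zsym i w \in s.
  by apply: contrapT => /negP h; apply: nb; left; exists i.
split => // [i k a|a m' k nk]; first exact: lik_gt0.
rewrite leNgt; apply/negP => h; apply: nb; right; exists k; split => //.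
by exists (a, m').
Qed.

Let llr_sum_le B w : (forall a m', {in s, forall e, `|llr m m' a e| <= B}) ->
  (forall i, Zsym i w \in s) -> forall a m' n, `|llr_sum w m a m' n| <= B * n%:R.
Proof.
move=> hB Zin a m' n; apply: le_trans (ler_norm_sum _ _ _) _.
apply: (@le_trans _ _ (\sum_(i < n) B)); first by apply: ler_sum => i _; exact: hB.
by rewrite sumr_const card_ord mulr_natr.
Qed.

Let Ntot_ext_ge0 c v w : (0 <= Ntot_ext c v w)%E.
Proof. by rewrite /Defs.Ntot_ext; case: (Ntot c v w) => [n|]; rewrite ?lee_fin ?leey. Qed.

Lemma EN_upper x : 1 / Im < x ->
  \forall c \near 0^'+, (EN c (u c) m <= (x * - ln c)%:E)%E.
Proof.
move=> Imx; have Imp := Im_gt0.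
have [C0 C00 priorC0] := prior_bound.
have [Is [Is0 IsIm Is_le]] := Is_exists.
have [B B0 hB] := llr_bound.
have x0 : 0 < x by apply: lt_trans Imx; rewrite divr_gt0.
have Imx' : 1 / x < Im by rewrite ltr_pdivrMr// mulrC -ltr_pdivrMr.
(* The second cap leaves Im - dl above the midpoint of 1 / x and Im, hence 1 / (Im - dl) < x. *)
pose dl := Num.min (Is / 2) ((Im - 1 / x) / 2).
have dl0 : 0 < dl by rewrite lt_min !divr_gt0// subr_gt0.
have dlIs : dl <= Is / 2 by rewrite ge_min lexx.
have dlx : dl <= (Im - 1 / x) / 2 by rewrite ge_min lexx orbT.
have g0 : 0 < Im - dl by lra.
have gx : 1 / (Im - dl) < x.
  rewrite ltr_pdivrMr//; have : 1 / x < Im - dl by lra.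
  by rewrite ltr_pdivrMr// mulrC.
(* The slack is split among three errors: the constant [A1], the first-stage cost [A2 * lam], and
   the cost ell A3 / (lam - C0 - 1) of wrong first decisions. *)
pose eps := (x - 1 / (Im - dl)) / 3.
have eps0 : 0 < eps by rewrite divr_gt0// subr_gt0.
have [C [rho [Cge rho0 rho1 tail]]] := bad_tail dl0.
have [V [V0 EV]] := integral_le_of_tail (bad_meas dl) Cge rho0 rho1 tail.
pose h := Is / 2; have h0 : 0 < h by rewrite divr_gt0.
pose b1 := 1 + 2 * B / h.
have b10 : 0 < b1 by rewrite ltr_wpDr// divr_ge0 ?mulr_ge0// ltW.
pose A1 := b1 * (C0 / h + 1) + C0 / h + 1 + (b1 + 1) * V.
pose A2 := b1 / h.
pose A3 := B / h * V.
have A10 : 0 <= A1.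
  have ch : 0 <= C0 / h by rewrite divr_ge0// ltW.
  have p1 : 0 <= b1 * (C0 / h + 1) by rewrite mulr_ge0 ?(ltW b10)// addr_ge0.
  have p2 : 0 <= (b1 + 1) * V by rewrite mulr_ge0// addr_ge0// ltW.
  by rewrite /A1; lra.
have A20 : 0 < A2 by rewrite divr_gt0.
have A30 : 0 <= A3 by rewrite mulr_ge0 ?divr_ge0// ltW.
pose A := C0 + 1 + A1 / eps + A3 / eps + 1.
have [a1 a3] : 0 <= A1 / eps /\ 0 <= A3 / eps by split; rewrite divr_ge0// ltW.
have eta0 : 0 < eps / A2 by rewrite divr_gt0.
near=> c.
have [/andP[c0 c12] /andP[u0 u12] Ac Au uc] :
  [/\ 0 < c <= 1 / 2, 0 < u c <= 1 / 2, A < - ln c, A < - ln (u c) &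
        - ln (u c) <= (eps / A2) * - ln c] by near: c; exact: scales.
have l0 : 0 < - ln (u c) by rewrite /A in Au; lra.
have e0 : 0 < - ln c by rewrite /A in Ac; lra.
have C1l : C0 + 1 < - ln (u c) by rewrite /A in Au; lra.
set lam := - ln (u c) in l0 Au uc C1l *; set ell := - ln c in e0 Ac uc *.
have lC : 0 < lam - (C0 + 1) by rewrite subr_gt0.
pose a := (b1 * ((lam + C0) / h + 1) + C0 / h + 1 + ell / (Im - dl)).
pose b := (b1 + 1 + ell * B / (h * (lam - (C0 + 1)))).
have a0 : 0 <= a.
  have p0 : 0 <= C0 / h by rewrite divr_ge0// ltW.
  have p1 : 0 <= (lam + C0) / h by rewrite divr_ge0 ?addr_ge0// ltW.
  have p2 : 0 <= b1 * ((lam + C0) / h + 1) by rewrite mulr_ge0 ?(ltW b10)// addr_ge0.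
  have p3 : 0 <= ell / (Im - dl) by rewrite divr_ge0// ltW.
  by rewrite /a; lra.
have b0 : 0 < b.
  have p1 : 0 <= ell * B / (h * (lam - (C0 + 1))) by rewrite divr_ge0 ?mulr_ge0// ltW.
  by rewrite /b; lra.
have ENle : (EN c (u c) m <= (a + b * V)%:E)%E.
  apply: EV => // n w nb; have [Zin likp dev] := not_badP nb.
  have [k NE kle] := total_time_upper C00 l0 e0 (llr_sum_le hB Zin)
    dev Is0 dl0 dlIs Is_le Im_le IsIm
    (path_N0_le prior_gt0 prior_sum priorC0 u0 likp (m := m))
    (path_D0_spec M_gt0 prior_gt0 prior_sum priorC0 u0 u12 likp m)
    (path_N_le prior_gt0 prior_sum priorC0 c0 likp (m := m)) C1l.
  by rewrite /Defs.Ntot_ext NE lee_fin.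
apply: le_trans ENle _; rewrite lee_fin.
have -> : a + b * V = A1 + A2 * lam + ell / (Im - dl) + ell * (A3 / (lam - (C0 + 1))).
  by rewrite /a /b /A1 /A2 /A3; field; rewrite !gt_eqF.
have k1 : A1 <= eps * ell.
  have : A1 / eps <= ell by rewrite /A in Ac; lra.
  by rewrite ler_pdivrMr// mulrC.
have k2 : A2 * lam <= eps * ell.
  have := ler_wpM2l (ltW A20) uc; rewrite mulrA (_ : A2 * (eps / A2) = eps)//.
  by field; rewrite gt_eqF.
have k3 : ell * (A3 / (lam - (C0 + 1))) <= eps * ell.
  rewrite mulrC ler_pM2r// ler_pdivrMr// mulrC -ler_pdivrMr//.
  by rewrite /A in Au; lra.
rewrite (_ : x * ell = eps * ell + eps * ell + eps * ell + ell / (Im - dl)); first lra.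
by rewrite /eps; field; rewrite gt_eqF.
Unshelve. all: by end_near. Qed.

Lemma EN_lower x : 0 < x -> x < 1 / Im ->
  \forall c \near 0^'+, ((x * - ln c)%:E <= EN c (u c) m)%E.
Proof.
move=> x0 xIm; have Imp := Im_gt0.
have [C0 C00 priorC0] := prior_bound.
have [Is [Is0 IsIm Is_le]] := Is_exists.
have [B B0 hB] := llr_bound.
have y1 : x * Im < 1 by rewrite -ltr_pdivlMr.
(* With x Im = 1 - 3 t, one t is spent on the probability of bad paths, one on lower-order terms in
   the time, one on the cone width; they fit because (1 - 3 t)(1 + t) <= (1 - t)^2. *)
pose t := (1 - x * Im) / 3.
have t0 : 0 < t by rewrite divr_gt0// subr_gt0.
have xI0 : 0 < x * Im by rewrite mulr_gt0.
have t1 : t < 1 by rewrite /t; lra.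
pose dl := Num.min (Is / 2) (t * Im).
have dl0 : 0 < dl by rewrite lt_min divr_gt0//= mulr_gt0.
have dlIs : dl <= Is / 2 by rewrite ge_min lexx.
have dlt : dl <= t * Im by rewrite ge_min lexx orbT.
have g0 : 0 < Im + dl by rewrite addr_gt0.
have [C [rho [Cge rho0 rho1 tail]]] := bad_tail dl0.
have [n nP] : exists n, C * rho ^+ n <= t.
  have cv : geometric C rho k @[k --> \oo] --> 0.
    by apply: cvg_geometric; rewrite gtr0_norm.
  have := cvgr_lt 0 cv t t0; move=> [n _ hn]; exists n.
  by apply: ltW; exact: (hn n (leqnn n)).
pose h := Is / 2; have h0 : 0 < h by rewrite divr_gt0.
pose A1 := C0 + 1 + 2 * B * (n%:R + (C0 / h + 1)) + B * n%:R.
(* The added 1 keeps [A2] positive when B = 0, as it is a divisor in the choice of eta. *)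
pose A2 := 2 * B / h + 1.
have A10 : 0 <= A1.
  have p1 : 0 <= C0 / h by rewrite divr_ge0// ltW.
  have p2 : 0 <= 2 * B * (n%:R + (C0 / h + 1)) by rewrite !mulr_ge0// !addr_ge0.
  have p3 : 0 <= B * n%:R by rewrite mulr_ge0.
  by rewrite /A1; lra.
have A20 : 0 < A2.
  have p1 : 0 <= 2 * B / h by rewrite divr_ge0 ?mulr_ge0// ltW.
  by rewrite /A2; lra.
pose A := C0 + 1 + B * n%:R + 2 * A1 / t + 1.
have a1 : 0 <= 2 * A1 / t by apply: divr_ge0; [exact: mulr_ge0|exact: ltW].
have Bn0 : 0 <= B * n%:R by rewrite mulr_ge0.
have eta0 : 0 < t / (2 * A2) by apply: divr_gt0 => //; exact: mulr_gt0.
near=> c.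
have [/andP[c0 c12] /andP[u0 u12] Ac Au uc] :
  [/\ 0 < c <= 1 / 2, 0 < u c <= 1 / 2, A < - ln c, A < - ln (u c) &
        - ln (u c) <= (t / (2 * A2)) * - ln c] by near: c; exact: scales.
have l0 : 0 < - ln (u c) by rewrite /A in Au; lra.
have e0 : 0 < - ln c by rewrite /A in Ac; lra.
have BlC : B * n%:R < - ln (u c) - (C0 + 1) by rewrite /A in Au; lra.
set lam := - ln (u c) in l0 Au uc BlC *; set ell := - ln c in e0 Ac uc *.
have k1 : A1 <= t / 2 * ell.
  have : 2 * A1 / t <= ell by rewrite /A in Ac; lra.
  by rewrite ler_pdivrMr//; lra.
have k2 : 2 * B / h * lam <= t / 2 * ell.
  have := ler_wpM2l (ltW A20) uc; rewrite mulrA (_ : A2 * (t / (2 * A2)) = t / 2); last first.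
    by field; rewrite gt_eqF.
  by rewrite /A2 mulrDl mul1r; lra.
have sumE : (C0 + 1) + 2 * B * (n%:R + ((lam + C0) / h + 1)) + B * n%:R =
    A1 + 2 * B / h * lam.
  by rewrite /A1; field; rewrite gt_eqF.
have lt_ell : t * ell < ell by rewrite -[ltRHS]mul1r ltr_pM2r.
have hell : 2 * B * (n%:R + ((lam + C0) / h + 1)) + B * n%:R < ell - (C0 + 1) by lra.
pose a := (ell - t * ell) / (Im + dl).
have a0 : 0 <= a by rewrite divr_ge0 ?(ltW g0)// subr_ge0 ltW.
have ENge : (a%:E * P m (~` bad dl n) <= EN c (u c) m)%E.
  apply: ge0_integral_ge_cst => //; first exact: measurableC.
  move=> w nb; have [Zin likp dev] := not_badP nb.
  rewrite /Defs.Ntot_ext; case NE : (Ntot c (u c) w) => [k|]; last by rewrite leey.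
  have := total_time_lower C00 l0 e0 (llr_sum_le hB Zin)
    dev Is0 dl0 dlIs Is_le IsIm
    (path_N0_le prior_gt0 prior_sum priorC0 u0 likp (m := m))
    (path_D0_spec M_gt0 prior_gt0 prior_sum priorC0 u0 u12 likp m)
    (path_N_spec M_gt0 prior_gt0 prior_sum priorC0 c0 c12 likp m)
    msm mean_ms BlC hell NE.
  rewrite lee_fin; apply: le_trans; rewrite ler_pM2r ?invr_gt0// -/h; lra.
apply: le_trans ENge.
have Pge : ((1 - t)%:E <= P m (~` bad dl n))%E.
  rewrite probability_setC// EFinB leeB//.
  by apply: le_trans (tail n) _; rewrite lee_fin.
apply: (@le_trans _ _ (a%:E * (1 - t)%:E)%E); last first.
  by apply: lee_wpmul2l; rewrite ?lee_fin.
rewrite -EFinM lee_fin /a mulrAC ler_pdivlMr//.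
have h1 : Im + dl <= Im * (1 + t) by lra.
have h2 : x * (Im + dl) <= x * Im * (1 + t) by rewrite -mulrA ler_pM2l.
have h3 : x * Im * (1 + t) <= (1 - t) * (1 - t).
  have -> : x * Im = 1 - 3 * t by rewrite /t; field.
  by nra.
have h4 := le_trans h2 h3.
have := ler_wpM2r (ltW e0) h4; lra.
Unshelve. all: by end_near. Qed.

(** Deciding k instead of m requires the likelihood ratio of k against m to exceed 1 / (c W) at the
    stopping time, which Ville's inequality bounds by c W. The sum over k gives the constant M W. *)
Lemma error_le : exists C : R, \forall c \near 0^'+,
  (P m [set w | Dfin c (u c) w <> Some m] <= (C * c)%:E)%E.
Proof.
have [C0 C00 priorC0] := prior_bound.
have [Is [Is0 IsIm Is_le]] := Is_exists.
have [B _ hB] := llr_bound.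
have dl0 : 0 < Is / 2 by rewrite divr_gt0.
pose W := expR (C0 + 1); have W0 : 0 < W by exact: expR_gt0.
exists (M%:R * W); near=> c.
have [/andP[c0 c12] /andP[u0 u12] Ac Au uc] :
  [/\ 0 < c <= 1 / 2, 0 < u c <= 1 / 2, C0 + 1 < - ln c, C0 + 1 < - ln (u c) &
        - ln (u c) <= 1 * - ln c] by near: c; exact: scales.
have l0 : 0 < - ln (u c) by lra.
have e0 : 0 < - ln c by lra.
pose md := mode2 P X prior phi0 (u c).
pose r (k : 'I_M) (a : option 'I_M) (e : symbol) := lik k a e / lik m a e.
pose F (k : 'I_M) := [set w | exists n, (c * W)^-1 <= mode_prod Zsym md (r k) n w].
have md_adapted n w w' : hist Zsym n w = hist Zsym n w' -> md n w = md n w'.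
  exact: mode2_adapted.
have mF k : measurable (F k).
  apply: (adapted_exists_measurable Zmeas) => n w w' ww'.
  by rewrite (mode_prod_adapted _ md_adapted ww').
have PF k : (P m (F k) <= (c * W)%:E)%E.
  have := ville Zmeas mass_ge0 Zs Zlaw md_adapted (r := r k) _ (mass_ratio k)
    (x := (c * W)^-1).
  rewrite invrK; apply; last by rewrite invr_gt0 mulr_gt0.
  by move=> a e; rewrite divr_ge0.
have [C [rho [Cge rho0 rho1 tail]]] := bad_tail dl0.
(* An infinite run makes [Dfin] equal to [None] and counts as an error. It can occur only on [G],
   which is null. *)
pose G := \bigcap_n bad (Is / 2) n.
have mG : measurable G by apply: bigcapT_measurable => n; exact: bad_meas.
have PG : P m G = 0%E.
  apply/eqP; rewrite eq_le measure_ge0 andbT; apply/lee_addgt0Pr => e e0'.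
  rewrite add0e.
  have cv : geometric C rho k @[k --> \oo] --> 0.
    by apply: cvg_geometric; rewrite gtr0_norm.
  have := cvgr_lt 0 cv e e0'; move=> [n _ hn].
  apply: (@le_trans _ _ (P m (bad (Is / 2) n))).
    by apply: le_measure; rewrite ?inE//; move=> w; apply.
  apply: le_trans (tail n) _; rewrite lee_fin; apply: ltW.
  exact: (hn n (leqnn n)).
have mD : measurable [set w | Dfin c (u c) w <> Some m].
  rewrite (_ : mkset _ = ~` [set w | Dfin c (u c) w = Some m])//.
  by apply: measurableC; exact: Dfin_measurable.
apply: (@le_trans _ _ (P m (G `|` \big[setU/set0]_(k <- enum 'I_M) F k))).
  apply: le_measure; rewrite ?inE//; first by apply: measurableU => //; exact: bigsetU_measurable.
  move=> w /= DE; have [wG|wG] := pselect (G w); [by left|right].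
  have [n nb] : exists n, ~ bad (Is / 2) n w.
    apply: contrapT => no; apply: wG => n _; apply: contrapT => nb.
    by apply: no; exists n.
  have [Zin likp dev] := not_badP nb.
  have [N NE _] := total_time_upper C00 l0 e0 (llr_sum_le hB Zin)
    dev Is0 dl0 (lexx _) Is_le Im_le IsIm
    (path_N0_le prior_gt0 prior_sum priorC0 u0 likp (m := m))
    (path_D0_spec M_gt0 prior_gt0 prior_sum priorC0 u0 u12 likp m)
    (path_N_le prior_gt0 prior_sum priorC0 c0 likp (m := m)) Au.
  have [k kE] := Dfin_some M_gt0 NE.
  have mk : m != k by apply/eqP => mk; apply: DE; rewrite kE mk.
  rewrite -bigcup_seq.
  exists k; first by rewrite /= mem_enum.
  have [N' _] := Dfin_llr_ge prior_gt0 prior_sum priorC0 c0 c12 likp kE mk.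
  have Lp k' : 0 < likprod P X phi0 phi J md N' w k' by apply: prodr_gt0.
  rewrite -ler_expR lnK ?posrE ?divr_gt0// => le1; exists N'.
  have -> : mode_prod Zsym md (r k) N' w =
      likprod P X phi0 phi J md N' w k / likprod P X phi0 phi J md N' w m.
    by rewrite /mode_prod /r prodf_div.
  apply: le_trans le1; rewrite invfM expRD !expRN lnK ?posrE//.
apply: le_trans (measureU2 _ _ _) _ => //; first exact: bigsetU_measurable.
rewrite -[leRHS]add0e; apply: leeD; first by rewrite -PG.
apply: le_trans (measure_bigsetU_le (P m) _ mF) _.
apply: (@le_trans _ _ (\sum_(k <- enum 'I_M) (c * W)%:E)%E).
  by apply: lee_sum => k _; exact: PF.
rewrite sumEFin lee_fin big_enum/= sumr_const card_ord.
by rewrite -[leLHS]mulr_natl -mulrA (mulrC c).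
Unshelve. all: by end_near. Qed.

End StateAsymptotics.

(** * Limits of the expected time and of the risk *)

Lemma cvg_sum_ord {R : realType} (n : nat) (F : set_system R) (FF : Filter F)
    (g : 'I_n -> R -> R) (l : 'I_n -> R) :
  (forall i, g i c @[c --> F] --> l i) ->
  (\sum_(i < n) g i c) @[c --> F] --> \sum_(i < n) l i.
Proof.
move=> gl; apply: (cvg_big (op := +%R)) => // x.
exact: add_continuous.
Qed.

Lemma ratio_cvg_of_bounds {R : realType} (e : R -> \bar R) (I : R) : 0 < I ->
  (\forall c \near (0 : R)^'+, 0 < - ln c) ->
  (forall x, 1 / I < x -> \forall c \near (0 : R)^'+, (e c <= (x * - ln c)%:E)%E) ->
  (forall x, 0 < x -> x < 1 / I -> \forall c \near (0 : R)^'+, ((x * - ln c)%:E <= e c)%E) ->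
  (\forall c \near (0 : R)^'+, (0 <= e c < +oo)%E) /\
  (fun c => fine (e c) / (`|ln c| / I)) @ (0 : R)^'+ --> (1 : R).
Proof.
move=> I0 lnear up low; have Ii0 : 0 < 1 / I by rewrite divr_gt0.
have fin : \forall c \near (0 : R)^'+, (0 <= e c < +oo)%E.
  near=> c.
  have l0 : 0 < - ln c by near: c.
  have h1 : (e c <= ((1 / I + 1) * - ln c)%:E)%E by near: c; apply: up; lra.
  have h2 : ((1 / I / 2 * - ln c)%:E <= e c)%E by near: c; apply: low; lra.
  rewrite (le_lt_trans h1) ?ltey// andbT; apply: le_trans h2.
  by rewrite lee_fin mulr_ge0 ?ltW// divr_gt0.
split => //; apply/cvgrPdist_le => eps eps0.
pose t := Num.min eps (1 / 2).
have t0 : 0 < t by rewrite lt_min eps0/=; lra.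
have t1 : t <= 1 / 2 by rewrite ge_min lexx orbT.
have te : t <= eps by rewrite ge_min lexx.
near=> c.
have l0 : 0 < - ln c by near: c.
have /andP[f1 f2] : (0 <= e c < +oo)%E by near: c.
have h1 : (e c <= ((1 / I * (1 + t)) * - ln c)%:E)%E.
  by near: c; apply: up; rewrite -[ltLHS]mulr1 ltr_pM2l//; lra.
have h2 : ((1 / I * (1 - t) * - ln c)%:E <= e c)%E.
  near: c; apply: low; first by rewrite mulr_gt0//; lra.
  by rewrite -[ltRHS]mulr1 ltr_pM2l//; lra.
have eE : e c = (fine (e c))%:E by rewrite fineK// ge0_fin_numE.
move: h1 h2; rewrite eE !lee_fin /=; move: (fine (e c)) => z h1 h2.
rewrite [`|ln c|]ltr0_norm; last by rewrite -oppr_gt0.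
set l := - ln c in l0 h1 h2 *.
have -> : z / (l / I) = z * I / l by field; rewrite !gt_eqF.
have k1 : z * I / l <= 1 + t.
  rewrite ler_pdivrMr//; have := ler_wpM2r (ltW I0) h1.
  by rewrite (_ : 1 / I * (1 + t) * l * I = (1 + t) * l)//; field; rewrite gt_eqF.
have k2 : 1 - t <= z * I / l.
  rewrite ler_pdivlMr//; have := ler_wpM2r (ltW I0) h2.
  by rewrite (_ : 1 / I * (1 - t) * l * I = (1 - t) * l)//; field; rewrite gt_eqF.
by rewrite ler_norml; apply/andP; split; lra.
Unshelve. all: by end_near. Qed.

(* [Imin] is [fine] of an infimum with default [+oo]; two states make the index
   set nonempty, so the minimum is attained. *)
Lemma Imin_attained {R : realType} {d} {Omega : measurableType d} {T : Type} {M : nat}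
    (P : 'I_M -> probability Omega R) (X : nat -> Omega -> T) (m : 'I_M)
    (K : nat) (p : nat -> R) (phi : nat -> T -> bool) : (2 <= M)%N ->
  (exists2 ms : 'I_M, ms != m & KLr P X m ms K p phi = Imin P X m K p phi) /\
  (forall m' : 'I_M, m' != m -> Imin P X m K p phi <= KLr P X m m' K p phi).
Proof.
move=> M2.
have [k km] : exists k : 'I_M, k != m.
  have M0 : (0 < M)%N by exact: ltnW.
  have [m0|m0] := eqVneq m (Ordinal M0).
    by exists (Ordinal M2); rewrite m0.
  by exists (Ordinal M0); rewrite eq_sym.
have [ms msm msE] := @eq_bigmin _ _ _ (+oo)%E k (fun m' => m' != m)
  (fun m' => (KLr P X m m' K p phi)%:E) km (fun _ _ => leey _).
have IE : Imin P X m K p phi = KLr P X m ms K p phi by rewrite /Imin msE.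
split; first by exists ms.
move=> m' m'm; rewrite IE -lee_fin -msE.
exact: (bigmin_le_cond _ (P := fun m' => m' != m)).
Qed.

(** Losses from wrong decisions are O(c), hence negligible against c |log c|; only the sampling cost
    survives normalization. *)
Lemma bayes_ratio_cvg {R : realType} {M : nat} (prior I : 'I_M -> R)
    (W : 'I_M -> 'I_M -> R) (e : 'I_M -> R -> \bar R) (q : 'I_M -> 'I_M -> R -> \bar R) :
  (0 < M)%N -> (forall m, 0 < prior m) -> (forall m, 0 < I m) ->
  (forall m, W m m = 0) ->
  (forall A : R, \forall c \near (0 : R)^'+, A < - ln c) ->
  (forall m, \forall c \near (0 : R)^'+, (0 <= e m c < +oo)%E) ->
  (forall m, (fun c => fine (e m c) / (`|ln c| / I m)) @ (0 : R)^'+ --> (1 : R)) ->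
  (forall m m' c, (0 <= q m m' c <= 1)%E) ->
  (forall m m', m' != m -> exists C : R, \forall c \near (0 : R)^'+, (q m m' c <= (C * c)%:E)%E) ->
  let risk c := (\sum_(m < M) (prior m)%:E *
     (c%:E * e m c + \sum_(m' < M) (W m m')%:E * q m m' c))%E in
  (\forall c \near (0 : R)^'+, (risk c < +oo)%E) /\
  (fun c => fine (risk c) / (c * `|ln c| * (\sum_(m < M) prior m / I m))) @ (0 : R)^'+ --> (1 : R).
Proof.
move=> M0 prior0 I0 W0 lnear efin ecvg q01 qle risk.
have qE m m' c : q m m' c = (fine (q m m' c))%:E.
  have /andP[h1 h2] := q01 m m' c; rewrite fineK// ge0_fin_numE//.
  by apply: le_lt_trans h2 _; rewrite ltey.
pose S := \sum_(m < M) prior m / I m.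
have S0 : 0 < S.
  rewrite /S (bigD1 (Ordinal M0))//= ltr_wpDr ?divr_gt0//.
  by apply: sumr_ge0 => m _; rewrite divr_ge0 ?ltW.
have riskE : \forall c \near (0 : R)^'+, risk c =
   (\sum_(m < M) prior m * (c * fine (e m c) + \sum_(m' < M) W m m' * fine (q m m' c)))%:E.
  have efin' : \forall c \near (0 : R)^'+, forall m, (0 <= e m c < +oo)%E.
    exact: filter_forall.
  near=> c.
  have ec m : (0 <= e m c < +oo)%E by move: m; near: c.
  rewrite /risk -sumEFin; apply: eq_bigr => m _; have /andP[h1 h2] := ec m.
  rewrite EFinM EFinD EFinM fineK ?ge0_fin_numE//; congr (_ * (_ + _))%E.
  by rewrite -sumEFin; apply: eq_bigr => m' _; rewrite [in LHS]qE.
split.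
  by near=> c; rewrite (near riskE c)// ltey.
have Wq m m' : (fun c => W m m' * (fine (q m m' c) / (c * - ln c))) @ (0 : R)^'+ --> (0 : R).
  have [->|m'm] := eqVneq m' m.
    rewrite (_ : (fun _ => _) = fun=> 0); first exact: cvg_cst.
    by apply/funext => c; rewrite W0 mul0r.
  rewrite -[X in _ --> X](mulr0 (W m m')); apply: cvgMl_tmp.
  apply/cvgrPdist_le => eps eps0; have [C qC] := qle m m' m'm.
  near=> c.
  have c0 : 0 < c by near: c; exact: nbhs_right_gt.
  have l0 : 0 < - ln c by near: c.
  have lC : C / eps < - ln c by near: c.
  have h : (q m m' c <= (C * c)%:E)%E by near: c.
  have /andP[q0 _] := q01 m m' c.
  move: h q0; rewrite qE !lee_fin /= => h q0.
  rewrite sub0r normrN ger0_norm; last by rewrite divr_ge0// mulr_ge0 ?ltW.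
  rewrite ler_pdivrMr ?mulr_gt0//; apply: le_trans h _.
  rewrite mulrCA [leRHS]mulrC ler_pM2r// mulrC.
  by move: lC; rewrite ltr_pdivrMr// => /ltW.
pose G (m : 'I_M) c := prior m * ((I m)^-1 * (fine (e m c) / (`|ln c| / I m)) +
    \sum_(m' < M) W m m' * (fine (q m m' c) / (c * - ln c))).
have Gcvg : (\sum_(m < M) G m c) / S @[c --> (0 : R)^'+] --> (1 : R).
  rewrite -[X in _ --> X](divff (lt0r_neq0 S0)); apply: cvgMr_tmp; apply: cvg_sum_ord => m.
  apply: cvgMl_tmp; rewrite -[X in _ --> X]addr0; apply: cvgD.
    by rewrite -[X in _ --> X]mulr1; apply: cvgMl_tmp; exact: ecvg.
  rewrite [X in _ --> X](_ : 0 = \sum_(m' < M) (0 : R)); last by rewrite big1.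
  by apply: cvg_sum_ord => m'; exact: Wq.
apply: cvg_trans Gcvg; apply: near_eq_cvg; near=> c.
have c0 : 0 < c by near: c; exact: nbhs_right_gt.
have l0 : 0 < - ln c by near: c.
rewrite (near riskE c)//= -/S invfM mulrA; congr (_ / S).
rewrite mulr_suml; apply: eq_bigr => m _; rewrite /G -[in RHS]mulrA; congr (_ * _).
rewrite mulrDl [`|ln c|]ltr0_norm; last by rewrite -oppr_gt0.
congr (_ + _); last by rewrite mulr_suml; apply: eq_bigr => m' _; rewrite mulrA.
have lc : ln c < 0 by rewrite -oppr_gt0.
by field; rewrite (gt_eqF c0) (lt_eqF lc) (gt_eqF (I0 m)).
Unshelve. all: by end_near. Qed.

Unset Implicit Arguments.

Theorem theorem4p1
  (R : realType) (dT : measure_display) (T : measurableType dT)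
  (mu : {measure set T -> \bar R})
  (dO : measure_display) (Omega : measurableType dO)
  (M : nat) (f : 'I_M -> T -> R) (P : 'I_M -> probability Omega R)
  (X : nat -> Omega -> T) (J : 'I_M -> nat -> Omega -> nat)
  (prior : 'I_M -> R) (W : 'I_M -> 'I_M -> R)
  (u : R -> R) (phi0 : T -> bool)
  (K : 'I_M -> nat) (p : 'I_M -> nat -> R) (phi : 'I_M -> nat -> T -> bool) :
  (* M >= 2 states; sigma-finite reference measure; densities *)
  (2 <= M)%N ->
  sigma_finite setT mu ->
  (forall m, measurable_fun setT (f m)) ->
  (forall m x, 0 <= f m x) ->
  (forall m, (\int[mu]_x (f m x)%:E = 1)%E) ->
  (* under P_m, X_1, X_2, ... (X n = X_{n+1}) have density f_m ... *)
  (forall n, measurable_fun setT (X n)) ->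
  (forall m n A, measurable A -> (P m (X n @^-1` A) = \int[mu]_(x in A) (f m x)%:E)%E) ->
  (* ... the quantizer selectors J m' n (time n+1, quantizer phibar_m') have law p m' ... *)
  (forall m' n k, measurable (J m' n @^-1` [set k])) ->
  (forall m m' n k, (P m (J m' n @^-1` [set k]) = (p m' k)%:E)%E) ->
  (* ... and all of these are mutually independent under every P_m *)
  (forall m, mutually_independent (P m)
     (fun i : (nat + (nat * 'I_M))%type =>
        match i with
        | inl n => [set X n @^-1` A | A in measurable]
        | inr (n, m') => [set J m' n @^-1` B | B in [set: set nat]]
        end)) ->
  (* standing assumption: 0 < E_m log(f_m(X_1)/f_m'(X_1)) < oo *)
  (forall m m' : 'I_M, m != m' ->
     {ae P m, forall w, 0 < f m' (X 0%N w)} /\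
     (0 < \int[P m]_w (ln (f m (X 0%N w) / f m' (X 0%N w)))%:E < +oo)%E) ->
  (* priors and losses *)
  (forall m, 0 < prior m) -> \sum_(m < M) prior m = 1 ->
  (forall m, W m m = 0) -> (forall m m', m != m' -> 0 < W m m') ->
  (* first-stage threshold u(c) *)
  (forall c, 0 < c -> 0 < u c < 1/2) ->
  u @ 0^'+ --> (0 : R) ->
  (fun c => ln (u c) / ln c) @ 0^'+ --> (0 : R) ->
  (* first-stage deterministic quantizer *)
  measurable [set x | phi0 x] ->
  (forall m m' : 'I_M, m != m' -> 0 < KLq P X m m' phi0) ->
  (* second-stage quantizers phibar_m = sum_{k < K m} p m k * phi m k *)
  (forall m k, measurable [set x | phi m k x]) ->
  (forall m k, 0 <= p m k) ->
  (forall m k, (K m <= k)%N -> p m k = 0) ->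
  (forall m, \sum_(k < K m) p m k = 1) ->
  (forall m m', 0 < Imin P X m (K m') (p m') (phi m')) ->
  (* conclusions *)
  (forall m,
     (\forall c \near 0^'+, EN P X prior phi0 phi J c (u c) m < +oo)%E /\
     (fun c => fine (EN P X prior phi0 phi J c (u c) m)
                 / (`|ln c| / Imin P X m (K m) (p m) (phi m)))
       @ 0^'+ --> (1 : R)) /\
  (forall m, exists C : R, \forall c \near 0^'+,
     (P m [set w | Dfin P X prior phi0 phi J c (u c) w <> Some m] <= (C * c)%:E)%E) /\
  (\forall c \near 0^'+, bayes_risk P X prior phi0 phi J W c (u c) < +oo)%E /\
  (fun c => fine (bayes_risk P X prior phi0 phi J W c (u c))
              / (c * `|ln c| * (\sum_(m < M) prior m / Imin P X m (K m) (p m) (phi m))))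
    @ 0^'+ --> (1 : R).
Proof.
move=> M2 _ f_meas f_ge0 _ X_meas X_law J_meas J_law indep standing prior_gt0 prior_sum
  W0 _ u01 u0 ratio0 phi0_meas kl0 phi_meas p_ge0 p_supp p_sum Imin_gt0.
have M0 : (0 < M)%N by exact: ltnW.
have X_ident m n A : measurable A -> P m (X n @^-1` A) = P m (X 0%N @^-1` A).
  by move=> mA; rewrite !X_law.
have X_null m m' A : measurable A ->
    P m' (X 0%N @^-1` A) = 0%E -> P m (X 0%N @^-1` A) = 0%E.
  move=> mA; have [-> //|mm'] := eqVneq m m'.
  apply: (density_null_transfer (X_meas 0%N) (f_meas m) (f_meas m') (f_ge0 m')
    (fun B mB => X_law m 0%N B mB) (fun B mB => X_law m' 0%N B mB) _ mA).
  by have [] := standing m m' mm'.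
pose s := good_symbols P X phi0 phi K.
pose mass := symbol_mass P X phi0 phi J.
pose mean m a m' := KLr P X m m' (Kfam K a) (pfam p a) (qfam phi0 phi a).
have scales := asymptotic_scales u01 u0 ratio0.
have Zmeas := Zsym_meas X_meas J_meas phi0_meas phi_meas.
have mass_ge0 m e : 0 <= mass m e by exact: symbol_mass_ge0.
have Zs m n := Zsym_good X_meas X_ident X_null J_meas J_law phi0_meas phi_meas p_supp m n.
have Zlaw m := hist_law X_meas X_ident J_law indep phi0_meas phi_meas (K := K) m.
have mass_sum m := symbol_mass_total X_meas X_ident X_null J_meas J_law indep
  phi0_meas phi_meas p_supp p_sum m.
have mass_llr m a m' := symbol_mass_llr X_meas X_ident X_null J_meas J_law indep
  phi0_meas phi_meas p_supp m m' a.
have mass_ratio m k a := symbol_mass_ratio X_meas X_ident X_null J_meas J_law indep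
  phi0_meas phi_meas p_ge0 p_supp p_sum m k a.
have lik_pos k a e (es : e \in s) : 0 < lik P X phi0 phi k a e.
  exact: good_symbol_lik es.
have lik_nneg k a e : 0 <= lik P X phi0 phi k a e by exact: lik_ge0.
(* The first-stage drift is a divergence of [phi0]; the others are at least I(m; phibar_k),
   including the families of wrong states. *)
have mean_gt0 m a (m' : 'I_M) : m' != m -> 0 < mean m a m'.
  move=> m'm; rewrite /mean; case: a => [k|] /=.
    have [_ h] := Imin_attained P X m (K k) (p k) (phi k) M2.
    exact: lt_le_trans (Imin_gt0 m k) (h m' m'm).
  rewrite /KLr big_ord1 /= mul1r; apply: kl0; by rewrite eq_sym.
pose I m := Imin P X m (K m) (p m) (phi m).
have I_gt0 m : 0 < I m by exact: Imin_gt0.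
have state m : exists ms : 'I_M, [/\ ms != m, mean m (Some m) ms = I m &
    forall m' : 'I_M, m' != m -> I m <= mean m (Some m) m'].
  by have [[ms h1 h2] h3] := Imin_attained P X m (K m) (p m) (phi m) M2; exists ms.
have lnear A : \forall c \near (0 : R)^'+, A < - ln c.
  by near=> c; have [] : [/\ 0 < c <= 1 / 2, 0 < u c <= 1 / 2, A < - ln c, A < - ln (u c) &
        - ln (u c) <= 1 * - ln c] by near: c; exact: scales.
have time m : (\forall c \near (0 : R)^'+,
      (0 <= EN P X prior phi0 phi J c (u c) m < +oo)%E) /\
    (fun c => fine (EN P X prior phi0 phi J c (u c) m) / (`|ln c| / I m)) @ (0 : R)^'+ --> (1 : R).
  have [ms [msm msE Ile]] := state m.
  apply: ratio_cvg_of_bounds => // x.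
    exact: (EN_upper M0 prior_gt0 prior_sum Zmeas (mass_ge0 m) (Zs m) (@Zlaw m)
      (mass_sum m) (mass_llr m) lik_pos (mean_gt0 m) msm msE Ile scales).
  exact: (EN_lower M0 prior_gt0 prior_sum Zmeas (mass_ge0 m) (Zs m) (@Zlaw m)
      (mass_sum m) (mass_llr m) lik_pos (mean_gt0 m) msm msE scales).
have error m : exists C : R, \forall c \near (0 : R)^'+,
    (P m [set w | Dfin P X prior phi0 phi J c (u c) w <> Some m] <= (C * c)%:E)%E.
  have [ms [msm msE Ile]] := state m.
  exact: (error_le M0 prior_gt0 prior_sum Zmeas (mass_ge0 m) (Zs m) (@Zlaw m)
      (mass_sum m) (mass_llr m) (mass_ratio m) lik_pos lik_nneg (mean_gt0 m) msm msE Ile scales).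
split.
  move=> m; have [h1 h2] := time m; split => //.
  by near=> c; have /andP[] : (0 <= EN P X prior phi0 phi J c (u c) m < +oo)%E by near: c.
split; first exact: error.
apply: (@bayes_ratio_cvg R M prior I W (fun m c => EN P X prior phi0 phi J c (u c) m)
  (fun m m' c => P m [set w | Dfin P X prior phi0 phi J c (u c) w = Some m'])) => //.
- by move=> m; have [] := time m.
- by move=> m; have [] := time m.
- by move=> m m' c; rewrite measure_ge0 probability_le1//; exact: Dfin_measurable.
move=> m m' m'm; have [C hC] := error m; exists C; near=> c.
have h : (P m [set w | Dfin P X prior phi0 phi J c (u c) w <> Some m] <= (C * c)%:E)%E.
  by near: c.
apply: le_trans h; apply: le_measure; rewrite ?inE.
- exact: Dfin_measurable.
- rewrite (_ : mkset _ = ~` [set w | Dfin P X prior phi0 phi J c (u c) w = Some m])//.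
  by apply: measurableC; exact: Dfin_measurable.
- by move=> w /= ->; case=> mm; rewrite mm eqxx in m'm.
Unshelve. all: by end_near. Qed.
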